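(* In the outer-domain setup, let $T>0$, $f_0\in C(\overline{U_T})$, $w_0\in C(\overline U)$, $G\in C(\Gamma\times[0,T])$, and let $w\in C^{2,1}_{x,t}(U_T)\cap C(\overline{U_T})$ be a bounded solution of $\mathcal Lw=f_0$ in $U_T$, $w(x,0)=w_0(x)$ in $U$, $w=G$ on $\Gamma\times(0,T]$. If $\lim_{|x|\to\infty}w_0(x)=0$ and $\lim_{|x|\to\infty}\sup_{0\le t\le T}|f_0(x,t)|=0$, then $\lim_{r\to\infty}\sup_{\mathcal S_r\times[0,T]}|w|=0$.
   Context: Setup. Fix $n\ge2$. For $i=1,2$: $g_i(s)=a^{(i)}_0+\sum_{j=1}^{N_i}a^{(i)}_js^{\alpha^{(i)}_j}$ ($s\ge0$), $a^{(i)}_0>0$, $a^{(i)}_j\ge0$, real $0<\alpha^{(i)}_1<\dots$; $G_i(u)=g_i(|u|)u$ ($u\in\mathbb R$). $f_1,f_2\in C([0,1])\cap C^1((0,1))$, $f_1(0)=0=f_2(1)$, $f_1'>0>f_2'$ on $(0,1)$; $p_c'\in C^1((0,1))$, $p_c'>0$; $F_i=1/(p_c'f_i)$. Fix $r_0>0$, $c_1,c_2$ with $c_1^2+c_2^2>0$, $s_0\in(0,1)$, and let $\hat S$ be a $C^1$ solution on $[r_0,\infty)$ of $\hat S'=G_2(c_2r^{1-n})F_2(\hat S)-G_1(c_1r^{1-n})F_1(\hat S)$, $\hat S(r_0)=s_0$, with $0<\underline s\le\hat S(r)\le\bar s<1$ for all $r\ge r_0$. For $|x|\ge r_0$: $S_*(x)=\hat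 S(|x|)$, $u_i^*(x)=c_i|x|^{-n}x$. For $u\in\mathbb R^n$: $\mathbf G_i(u)=g_i(|u|)u$, Jacobian $\mathbf G_i'(u)=g_i(|u|)I_n+g_i'(|u|)uu^T/|u|$ ($=g_i(0)I_n$ at $u=0$). $B=F_1(S_* )\mathbf G_1'(u_1^* )+F_2(S_* )\mathbf G_2'(u_2^* )$, $A=B^{-1}$, $b=F_2'(S_* )\mathbf G_2(u_2^* )-F_1'(S_* )\mathbf G_1(u_1^* )$. $\mathcal Lw=\partial_tw-\nabla\cdot(A\nabla w)-b\cdot(A\nabla w)$. Outer domain: $U=\mathbb R^n\setminus\overline{B_{r_0}}$, $\Gamma=\{|x|=r_0\}$, $U_T=U\times(0,T]$, $\overline{U_T}=\overline U\times[0,T]$, $\mathcal S_r=\{|x|=r\}$. $C^{2,1}_{x,t}$ as usual. *)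

(* Defs.v *)
(* Stdlib reals.  Points of R^n are encoded as  x : nat -> R  together
   with the predicate  inRn n x  (all coordinates of index >= n vanish). *)
From Stdlib Require Import Reals Lra.
Open Scope R_scope.

Definition Vec := nat -> R.

Fixpoint sum_lt (n : nat) (f : nat -> R) : R :=
  match n with O => 0 | S m => sum_lt m f + f m end.

Definition inRn (n : nat) (x : Vec) : Prop := forall i, (n <= i)%nat -> x i = 0.

Definition vnorm (n : nat) (x : Vec) : R := sqrt (sum_lt n (fun i => x i * x i)).

Definition vsub (x y : Vec) : Vec := fun i => x i - y i.

Definition kron (i j : nat) : R := if Nat.eqb i j then 1 else 0.

Definition shift (x : Vec) (i : nat) (h : R) : Vec :=
  fun j => if Nat.eqb j i then x j + h else x j.

(* s^a for s >= 0, a > 0 (with 0^a = 0) *)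
Definition rpow (s a : R) : R := if Rle_dec s 0 then 0 else Rpower s a.

(* Data of g(s) = a_0 + sum_{j=1}^N a_j s^{alpha_j} *)
Record gdata := { ga0 : R; gN : nat; ga : nat -> R; gal : nat -> R }.

Definition gdata_ok (d : gdata) : Prop :=
  0 < ga0 d /\
  (forall j, (1 <= j <= gN d)%nat -> 0 <= ga d j) /\
  (forall j, (1 <= j <= gN d)%nat -> 0 < gal d j) /\
  (forall j, (1 <= j < gN d)%nat -> gal d j < gal d (S j)).

Definition gfun (d : gdata) (s : R) : R :=
  ga0 d + sum_lt (gN d) (fun k => ga d (S k) * rpow s (gal d (S k))).

(* g'(s), for s > 0 *)
Definition gder (d : gdata) (s : R) : R :=
  sum_lt (gN d) (fun k => ga d (S k) * gal d (S k) * Rpower s (gal d (S k) - 1)).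

Definition Gsc (d : gdata) (u : R) : R := gfun d (Rabs u) * u.

Definition Gvec (d : gdata) (n : nat) (u : Vec) : Vec :=
  fun i => gfun d (vnorm n u) * u i.

Definition Gjac (d : gdata) (n : nat) (u : Vec) (i j : nat) : R :=
  if Rle_dec (vnorm n u) 0 then gfun d 0 * kron i j
  else gfun d (vnorm n u) * kron i j + gder d (vnorm n u) * u i * u j / vnorm n u.

(* F = 1/(p_c' f) *)
Definition Ffun (pc f : R -> R) (s : R) : R := / (pc s * f s).

Definition ustar (c : R) (n : nat) (x : Vec) : Vec :=
  fun i => c * x i / (vnorm n x ^ n).

Definition ode_rhs (d1 d2 : gdata) (pc f1 f2 : R -> R) (c1 c2 : R) (n : nat)
  (r s : R) : R :=
  Gsc d2 (c2 / r ^ (n - 1)) * Ffun pc f2 s - Gsc d1 (c1 / r ^ (n - 1)) * Ffun pc f1 s.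

Definition deriv_within (P : R -> Prop) (f : R -> R) (t l : R) : Prop :=
  forall eps, 0 < eps -> exists delta, 0 < delta /\
    forall h, h <> 0 -> Rabs h < delta -> P (t + h) ->
      Rabs ((f (t + h) - f t) / h - l) < eps.

Definition cont_on_R (P : R -> Prop) (f : R -> R) : Prop :=
  forall x, P x -> forall eps, 0 < eps -> exists delta, 0 < delta /\
    forall y, P y -> Rabs (y - x) < delta -> Rabs (f y - f x) < eps.

Definition cont_on_x (n : nat) (P : Vec -> Prop) (f : Vec -> R) : Prop :=
  forall x, P x -> forall eps, 0 < eps -> exists delta, 0 < delta /\
    forall y, P y -> vnorm n (vsub y x) < delta -> Rabs (f y - f x) < eps.

Definition cont_on_xt (n : nat) (P : Vec -> R -> Prop) (f : Vec -> R -> R) : Prop :=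
  forall x t, P x t -> forall eps, 0 < eps -> exists delta, 0 < delta /\
    forall y s, P y s -> vnorm n (vsub y x) < delta -> Rabs (s - t) < delta ->
      Rabs (f y s - f x t) < eps.

Definition Udom (n : nat) (r0 : R) (x : Vec) : Prop := inRn n x /\ r0 < vnorm n x.
Definition Ubar (n : nat) (r0 : R) (x : Vec) : Prop := inRn n x /\ r0 <= vnorm n x.
Definition Gam (n : nat) (r0 : R) (x : Vec) : Prop := inRn n x /\ vnorm n x = r0.
Definition UT (n : nat) (r0 T : R) (x : Vec) (t : R) : Prop := Udom n r0 x /\ 0 < t <= T.
Definition UTbar (n : nat) (r0 T : R) (x : Vec) (t : R) : Prop := Ubar n r0 x /\ 0 <= t <= T.

Definition Bmat (d1 d2 : gdata) (pc f1 f2 : R -> R) (c1 c2 : R) (n : nat)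
  (Shat : R -> R) (x : Vec) (i j : nat) : R :=
  Ffun pc f1 (Shat (vnorm n x)) * Gjac d1 n (ustar c1 n x) i j
  + Ffun pc f2 (Shat (vnorm n x)) * Gjac d2 n (ustar c2 n x) i j.

Definition bvec (d1 d2 : gdata) (dF1 dF2 : R -> R) (c1 c2 : R) (n : nat)
  (Shat : R -> R) (x : Vec) (i : nat) : R :=
  dF2 (Shat (vnorm n x)) * Gvec d2 n (ustar c2 n x) i
  - dF1 (Shat (vnorm n x)) * Gvec d1 n (ustar c1 n x) i.

Definition Aflux (Am : Vec -> nat -> nat -> R) (wx : nat -> Vec -> R -> R)
  (n : nat) (x : Vec) (t : R) (i : nat) : R :=
  sum_lt n (fun j => Am x i j * wx j x t).

(* Main.v *)
(* The matrix B is radial: on the line of x it acts as the scalar lambda(|x|), on the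
   orthogonal complement as beta(|x|), where lambda comes from G_i' = (s g_i(s))' and beta
   from g_i.  Hence A has eigenvalues a = 1/lambda and 1/beta, and the gradient of a radial
   function phi(|x|^2) has flux 2 a phi' x.  The function a and its derivative are bounded,
   because Shat stays in a compact subset of (0,1) and solves an ODE with bounded right-hand
   side; also b.x is bounded.  Therefore, for K large,
     eps (1 + t) + e^{K t} (M R0^2 / |x|^2 + dl |x|^2)
   is a strict supersolution on |x| >= R0.  For R0 large it dominates w at t = 0, on
   |x| = R0, and for |x| large; at a positive interior maximum of the difference the
   gradient vanishes, the Hessian is nonpositive, and f0 > eps, which is absurd.  Letting
   dl tend to 0, then |x| to infinity, bounds w from above; the same applies to -w. *)
Require Import Defs.
From Stdlib Require Import Reals Lra Lia FunctionalExtensionality ClassicalEpsilon.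
From Coquelicot Require Import Coquelicot.
Open Scope R_scope.

(** * Finite sums and Euclidean vectors *)

(** Far out, only boundedness of w is known, and the sphere |x| = R0 carries no smallness either.
    The term M R0^2/|x|^2 equals the bound M exactly on that sphere and decays; dl |x|^2 exceeds M
    on a large sphere and so confines the comparison to a compact cylinder. In eps (1 + t) the
    constant pays for the initial values and the slope for f0.

    With rho = |x|^2, neither 1/rho nor rho need be a stationary supersolution. For both, however,
    |phi'| rho <= phi and phi'' rho^2 <= 2 phi, so on |x| >= 1 the spatial operator costs at most a
    fixed multiple of phi, which e^{K t} absorbs; T being finite, this factor stays bounded. The
    bound on b.x is where n >= 2 enters: b is O(|x|^{1-n}), hence b.x is O(|x|^{2-n}).

    The equation supplies a derivative of the whole flux, not of A and grad w separately.
    Differentiability of A is therefore read off from an explicit inverse of B, and at a contact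
    point the flux is compared with that of the radial function; of the derivatives of A only a'
    survives there. *)

Lemma sum_lt_ext (n : nat) (f g : nat -> R) :
  (forall i, (i < n)%nat -> f i = g i) -> sum_lt n f = sum_lt n g.
Proof.
induction n as [|n IH]; intros H; simpl; [reflexivity|].
rewrite IH, H; auto.
Qed.

Lemma sum_lt_plus (n : nat) (f g : nat -> R) :
  sum_lt n (fun i => f i + g i) = sum_lt n f + sum_lt n g.
Proof. induction n as [|n IH]; simpl; [lra|rewrite IH; lra]. Qed.

Lemma sum_lt_scal (n : nat) (c : R) (f : nat -> R) :
  sum_lt n (fun i => c * f i) = c * sum_lt n f.
Proof. induction n as [|n IH]; simpl; [lra|rewrite IH; lra]. Qed.

Lemma sum_lt_le (n : nat) (f g : nat -> R) :
  (forall i, (i < n)%nat -> f i <= g i) -> sum_lt n f <= sum_lt n g.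
Proof.
induction n as [|n IH]; intros H; simpl; [lra|].
apply Rplus_le_compat; auto.
Qed.

Lemma sum_lt_nonneg (n : nat) (f : nat -> R) :
  (forall i, (i < n)%nat -> 0 <= f i) -> 0 <= sum_lt n f.
Proof.
induction n as [|n IH]; intros H; simpl; [lra|].
apply Rplus_le_le_0_compat; auto.
Qed.

Lemma sum_lt_const (n : nat) (c : R) : sum_lt n (fun _ => c) = INR n * c.
Proof. induction n as [|n IH]; [simpl; lra|rewrite S_INR; simpl sum_lt; rewrite IH; lra]. Qed.

Lemma sum_lt_swap (n m : nat) (f : nat -> nat -> R) :
  sum_lt n (fun i => sum_lt m (f i)) = sum_lt m (fun j => sum_lt n (fun i => f i j)).
Proof.
induction n as [|n IH]; simpl.
- induction m as [|m IHm]; simpl; [reflexivity|rewrite <- IHm; lra].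
- rewrite IH, <- sum_lt_plus. apply sum_lt_ext; intros; lra.
Qed.

Lemma kron_eq (i : nat) : kron i i = 1.
Proof. unfold kron; now rewrite Nat.eqb_refl. Qed.

Lemma kron_neq (i j : nat) : i <> j -> kron i j = 0.
Proof. intros H; unfold kron; destruct (Nat.eqb_spec i j); congruence. Qed.

Lemma sum_lt_kron (n k : nat) (f : nat -> R) :
  (k < n)%nat -> sum_lt n (fun i => kron k i * f i) = f k.
Proof.
assert (H0 : forall m, (m <= k)%nat -> sum_lt m (fun i => kron k i * f i) = 0).
{ induction m as [|m IH]; intros Hm; simpl; [lra|].
  rewrite IH by lia; rewrite kron_neq by lia; lra. }
induction n as [|n IH]; intros H; [lia|]; simpl.
destruct (Nat.eq_dec k n) as [->|E].
- rewrite H0 by lia; rewrite kron_eq; lra.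
- rewrite IH by lia; rewrite kron_neq by lia; lra.
Qed.

Lemma kron_sym (i j : nat) : kron i j = kron j i.
Proof. unfold kron; now rewrite Nat.eqb_sym. Qed.

Definition sqn (n : nat) (x : Vec) : R := sum_lt n (fun i => x i * x i).
Definition dot (n : nat) (x y : Vec) : R := sum_lt n (fun i => x i * y i).
Definition vadd (x y : Vec) (s : R) : Vec := fun i => x i + s * y i.

Lemma sqn_nonneg (n : nat) (x : Vec) : 0 <= sqn n x.
Proof. apply sum_lt_nonneg; intros; nra. Qed.

Lemma vnorm_nonneg (n : nat) (x : Vec) : 0 <= vnorm n x.
Proof. apply sqrt_pos. Qed.

Lemma vnorm_sqr (n : nat) (x : Vec) : vnorm n x * vnorm n x = sqn n x.
Proof. apply sqrt_sqrt, sqn_nonneg. Qed.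

Lemma sqn_scal (n : nat) (c : R) (x : Vec) : sqn n (fun i => c * x i) = c * c * sqn n x.
Proof.
unfold sqn; rewrite <- sum_lt_scal; apply sum_lt_ext; intros; ring.
Qed.

Lemma vnorm_scal (n : nat) (c : R) (x : Vec) : vnorm n (fun i => c * x i) = Rabs c * vnorm n x.
Proof.
apply Rsqr_inj; try apply vnorm_nonneg.
- apply Rmult_le_pos; [apply Rabs_pos|apply vnorm_nonneg].
- unfold Rsqr; rewrite vnorm_sqr, sqn_scal, <- vnorm_sqr.
  pose proof (Rsqr_abs c) as E; unfold Rsqr in E; rewrite E; ring.
Qed.

Lemma vnorm_mono (n : nat) (x y : Vec) :
  (forall i, (i < n)%nat -> Rabs (x i) <= Rabs (y i)) -> vnorm n x <= vnorm n y.
Proof.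
intros H; apply sqrt_le_1_alt, sum_lt_le; intros i Hi.
pose proof (Rsqr_abs (x i)) as E1; pose proof (Rsqr_abs (y i)) as E2; unfold Rsqr in *.
rewrite E1, E2. pose proof (H i Hi); pose proof (Rabs_pos (x i)); nra.
Qed.

Lemma coord_le_vnorm (n : nat) (x : Vec) (i : nat) : (i < n)%nat -> Rabs (x i) <= vnorm n x.
Proof.
intros Hi; rewrite <- sqrt_Rsqr_abs; apply sqrt_le_1_alt; unfold Rsqr.
induction n as [|n IH]; [lia|simpl].
destruct (Nat.eq_dec i n) as [->|E].
- pose proof (sqn_nonneg n x) as P; unfold sqn in P; lra.
- pose proof (IH ltac:(lia)); nra.
Qed.

Lemma sqn_vadd (n : nat) (x y : Vec) (s : R) :
  sqn n (vadd x y s) = sqn n x + 2 * s * dot n x y + s * s * sqn n y.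
Proof.
unfold sqn, dot, vadd; rewrite <- !sum_lt_scal, <- !sum_lt_plus.
apply sum_lt_ext; intros; ring.
Qed.

Lemma shift_vadd (x : Vec) (i : nat) (h : R) : shift x i h = vadd x (kron i) h.
Proof.
apply functional_extensionality; intros j; unfold shift, vadd, kron.
rewrite (Nat.eqb_sym i j); destruct (Nat.eqb j i); ring.
Qed.

Lemma inRn_vadd (n : nat) (x y : Vec) (s : R) : inRn n x -> inRn n y -> inRn n (vadd x y s).
Proof. intros Hx Hy i Hi; unfold vadd; rewrite Hx, Hy by assumption; ring. Qed.

Lemma inRn_kron (n i : nat) : (i < n)%nat -> inRn n (kron i).
Proof. intros H j Hj; apply kron_neq; lia. Qed.

Lemma dot_kron (n i : nat) (x : Vec) : (i < n)%nat -> dot n x (kron i) = x i.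
Proof.
intros H; unfold dot; rewrite (sum_lt_ext n _ (fun j => kron i j * x j)) by (intros; ring).
now apply sum_lt_kron.
Qed.

Lemma sqn_kron (n i : nat) : (i < n)%nat -> sqn n (kron i) = 1.
Proof. intros H; unfold sqn; rewrite sum_lt_kron by exact H; apply kron_eq. Qed.

Definition bil (n : nat) (D : nat -> nat -> R) (u v : Vec) : R :=
  sum_lt n (fun i => sum_lt n (fun j => u i * v j * D i j)).

Lemma bil_vadd_l (n : nat) D (u u' v : Vec) (s : R) :
  bil n D (vadd u u' s) v = bil n D u v + s * bil n D u' v.
Proof.
unfold bil, vadd; rewrite <- sum_lt_scal, <- sum_lt_plus; apply sum_lt_ext; intros i _.
rewrite <- sum_lt_scal, <- sum_lt_plus; apply sum_lt_ext; intros; ring.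
Qed.

Lemma bil_vadd_r (n : nat) D (u v v' : Vec) (s : R) :
  bil n D u (vadd v v' s) = bil n D u v + s * bil n D u v'.
Proof.
unfold bil, vadd; rewrite <- sum_lt_scal, <- sum_lt_plus; apply sum_lt_ext; intros i _.
rewrite <- sum_lt_scal, <- sum_lt_plus; apply sum_lt_ext; intros; ring.
Qed.

Lemma bil_kron_l (n k : nat) D (v : Vec) : (k < n)%nat ->
  bil n D (kron k) v = sum_lt n (fun j => v j * D k j).
Proof.
intros H; unfold bil.
rewrite (sum_lt_ext n _ (fun i => kron k i * sum_lt n (fun j => v j * D i j))).
- now rewrite sum_lt_kron.
- intros i _; rewrite <- sum_lt_scal; apply sum_lt_ext; intros; ring.
Qed.

Lemma bil_kron_r (n k : nat) D (u : Vec) : (k < n)%nat ->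
  bil n D u (kron k) = sum_lt n (fun i => u i * D i k).
Proof.
intros H; unfold bil; apply sum_lt_ext; intros i _.
rewrite (sum_lt_ext n _ (fun j => kron k j * (u i * D i j))) by (intros; ring).
now rewrite sum_lt_kron.
Qed.

(* With e = x/|x|, the vectors e_k - (e_k.e) e satisfy
   sum_k Q(e_k - (e_k.e) e) = tr D - Q(e). *)
Lemma trace_perp_nonpos (n : nat) D (x : Vec) : inRn n x -> 0 < sqn n x ->
  (forall u, inRn n u -> bil n D u u <= 0) ->
  sum_lt n (fun k => D k k) - bil n D x x / sqn n x <= 0.
Proof.
intros Hx Hr HD.
assert (E : sum_lt n (fun k => let u := vadd (kron k) x (- (x k / sqn n x)) in bil n D u u)
   = sum_lt n (fun k => D k k) - bil n D x x / sqn n x).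
{ rewrite (sum_lt_ext n _ (fun k => D k k +
     (- / sqn n x * sum_lt n (fun j => x k * x j * D k j)
      + (- / sqn n x * sum_lt n (fun i => x i * x k * D i k)
      + bil n D x x / (sqn n x * sqn n x) * (x k * x k))))).
  2:{ intros k Hk; cbv zeta.
      rewrite bil_vadd_l, !bil_vadd_r, !bil_kron_l, bil_kron_r by exact Hk.
      rewrite sum_lt_kron by exact Hk.
      rewrite (sum_lt_ext n (fun j => x k * x j * D k j) (fun j => x k * (x j * D k j)))
        by (intros; ring).
      rewrite (sum_lt_ext n (fun i => x i * x k * D i k) (fun i => x k * (x i * D i k)))
        by (intros; ring).
      rewrite !sum_lt_scal; field; lra. }
  rewrite !sum_lt_plus, !sum_lt_scal, (sum_lt_swap n n (fun k i => x i * x k * D i k)).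
  fold (bil n D x x); fold (sqn n x); unfold bil at 2.
  fold (bil n D x x); field; lra. }
rewrite <- E.
assert (H : forall m, (m <= n)%nat -> sum_lt m (fun k => let u := vadd (kron k) x (- (x k / sqn n x)) in bil n D u u) <= 0).
{ induction m as [|m IH]; intros Hm; simpl; [lra|].
  assert (bil n D (vadd (kron m) x (- (x m / sqn n x))) (vadd (kron m) x (- (x m / sqn n x))) <= 0).
  { apply HD, inRn_vadd; [apply inRn_kron; lia|exact Hx]. }
  pose proof (IH ltac:(lia)); cbv zeta in *; lra. }
now apply H.
Qed.

(** With e = x/|x| and Q the quadratic form of [D], the contraction equals al (tr D - Q(e)) + a
    Q(e), a positive combination of two nonpositive numbers. *)
Lemma radial_contraction_nonpos (n : nat) D (x : Vec) (al a : R) :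
  inRn n x -> 0 < sqn n x -> 0 < al -> 0 < a ->
  (forall u, inRn n u -> bil n D u u <= 0) ->
  sum_lt n (fun i => sum_lt n (fun j =>
    (al * kron i j + (a - al) * (x i * x j / sqn n x)) * D i j)) <= 0.
Proof.
intros Hx Hr Hal Ha HD.
rewrite (sum_lt_ext n _ (fun i => al * D i i
   + (a - al) / sqn n x * sum_lt n (fun j => x i * x j * D i j))).
2:{ intros i Hi.
    rewrite (sum_lt_ext n _ (fun j => kron i j * (al * D i j)
        + (a - al) / sqn n x * (x i * x j * D i j))) by (intros; field; lra).
    now rewrite sum_lt_plus, sum_lt_kron, sum_lt_scal. }
rewrite sum_lt_plus, !sum_lt_scal; fold (bil n D x x).
pose proof (trace_perp_nonpos n D x Hx Hr HD) as H1; pose proof (HD x Hx) as H2.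
replace (_ + _) with (al * (sum_lt n (fun k => D k k) - bil n D x x / sqn n x)
   + a * (bil n D x x / sqn n x)) by (field; lra).
assert (bil n D x x / sqn n x <= 0).
{ apply Rmult_le_reg_r with (sqn n x); [exact Hr|]; field_simplify; lra. }
nra.
Qed.

(** * Compactness *)

Definition extraction (phi : nat -> nat) : Prop := forall k, (phi k < phi (S k))%nat.

Lemma extraction_ge (phi : nat -> nat) : extraction phi -> forall k, (k <= phi k)%nat.
Proof. intros H; induction k as [|k IH]; [lia|specialize (H k); lia]. Qed.

Lemma extraction_comp (phi psi : nat -> nat) :
  extraction phi -> extraction psi -> extraction (fun k => phi (psi k)).
Proof.
intros H1 H2 k.
assert (M : forall m p, (m < p)%nat -> (phi m < phi p)%nat).
{ induction 1; [apply H1|specialize (H1 m0); lia]. }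
apply M, H2.
Qed.

Lemma Un_cv_extraction (u : nat -> R) (l : R) (phi : nat -> nat) :
  extraction phi -> Un_cv u l -> Un_cv (fun k => u (phi k)) l.
Proof.
intros H Hu e He; destruct (Hu e He) as [N HN]; exists N; intros k Hk.
apply HN; pose proof (extraction_ge phi H k); lia.
Qed.

(** Bolzano-Weierstrass yields a cluster point only; the subsequence converging to it is extracted
    by choice. *)
Lemma bounded_subseq (u : nat -> R) (M : R) : (forall k, Rabs (u k) <= M) ->
  exists phi l, extraction phi /\ Un_cv (fun k => u (phi k)) l.
Proof.
intros Hb.
destruct (Bolzano_Weierstrass u (fun c => - M <= c <= M)) as [l Hl].
{ apply compact_P3. }
{ intros k; pose proof (Hb k); split; apply Rabs_le_between in H; lra. }
assert (P : forall k N, exists p, (N <= p)%nat /\ Rabs (u p - l) < / (INR k + 1)).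
{ intros k N.
  assert (Hk : 0 < / (INR k + 1)) by (apply Rinv_0_lt_compat; pose proof (pos_INR k); lra).
  destruct (Hl (disc l (mkposreal _ Hk)) N) as [p [H1 H2]].
  - exists (mkposreal _ Hk); intros y Hy; exact Hy.
  - exists p; split; [exact H1|exact H2]. }
pose (f := fun k N => proj1_sig (constructive_indefinite_description _ (P k N))).
assert (Hf : forall k N, (N <= f k N)%nat /\ Rabs (u (f k N) - l) < / (INR k + 1)).
{ intros k N; unfold f; destruct (constructive_indefinite_description _ (P k N)) as [p Hp]; exact Hp. }
(* Each index is chosen beyond the previous one, with a value within 1/(k+1) of the cluster
   point. *)
pose (phi := fix phi k := match k with O => f O O | S m => f (S m) (S (phi m)) end).
exists phi, l; split.
- intros k; simpl; destruct (Hf (S k) (S (phi k))) as [H _]; simpl in H; lia.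
- intros e He.
  destruct (INR_unbounded (/ e)) as [N HN]; exists N; intros k Hk.
  assert (H : Rabs (u (phi k) - l) < / (INR k + 1)).
  { destruct k; simpl phi; apply Hf. }
  unfold Rdist; apply Rlt_trans with (1 := H).
  rewrite <- (Rinv_inv e); apply Rinv_lt_contravar.
  + apply Rmult_lt_0_compat; [now apply Rinv_0_lt_compat|pose proof (pos_INR k); lra].
  + apply le_INR in Hk; lra.
Qed.

(** Induction on the dimension, refining the subsequence once per coordinate; the limit is set to 0
    from index [n] on, so that it represents a point of R^n. *)
Lemma bounded_subseq_vec (n : nat) (u : nat -> Vec) (M : R) :
  (forall k i, (i < n)%nat -> Rabs (u k i) <= M) ->
  exists phi l, extraction phi /\ inRn n l /\
    forall i, (i < n)%nat -> Un_cv (fun k => u (phi k) i) (l i).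
Proof.
induction n as [|n IH]; intros Hb.
- exists (fun k => k), (fun _ => 0); split; [intros k; lia|split; [intros i _; reflexivity|lia]].
- destruct IH as (phi & l & H1 & H2 & H3); [intros; apply Hb; lia|].
  destruct (bounded_subseq (fun k => u (phi k) n) M) as (psi & y & H4 & H5).
  { intros; apply Hb; lia. }
  exists (fun k => phi (psi k)), (fun i => if Nat.eqb i n then y else l i).
  split; [now apply extraction_comp|split].
  + intros i Hi; destruct (Nat.eqb_spec i n); [lia|apply H2; lia].
  + intros i Hi; destruct (Nat.eqb_spec i n) as [->|E]; [exact H5|].
    apply (Un_cv_extraction (fun k => u (phi k) i)); [exact H4|apply H3; lia].
Qed.

Definition cvg_xt (n : nat) (u : nat -> Vec) (tau : nat -> R) (x : Vec) (t : R) : Prop :=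
  (forall i, (i < n)%nat -> Un_cv (fun k => u k i) (x i)) /\ Un_cv tau t.

(** A maximising sequence has a convergent subsequence, and its limit attains the supremum.
    Closedness of [K] and continuity of [V] are asked jointly along sequences. Convergence only
    concerns the first [n] coordinates, so [inRn] is what pins down the limit vector. *)
Lemma compact_max (n : nat) (K : Vec -> R -> Prop) (V : Vec -> R -> R) (C M : R) :
  (forall x t, K x t -> (forall i, (i < n)%nat -> Rabs (x i) <= C) /\ Rabs t <= C) ->
  (forall u tau x t, (forall k, K (u k) (tau k)) -> inRn n x -> cvg_xt n u tau x t ->
     K x t /\ Un_cv (fun k => V (u k) (tau k)) (V x t)) ->
  (forall x t, K x t -> V x t <= M) -> (exists x t, K x t) ->
  exists x t, K x t /\ forall y s, K y s -> V y s <= V x t.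
Proof.
intros HC Hcl HM [x0 [t0 H0]].
destruct (completeness (fun v => exists x t, K x t /\ v = V x t)) as [m [Hub Hlub]].
{ exists M; intros v (x & t & H & ->); now apply HM. }
{ exists (V x0 t0), x0, t0; auto. }
assert (P : forall k, exists p, K (fst p) (snd p) /\ m - / (INR k + 1) < V (fst p) (snd p)).
{ intros k.
  assert (Hk : 0 < / (INR k + 1)) by (apply Rinv_0_lt_compat; pose proof (pos_INR k); lra).
  destruct (excluded_middle_informative (exists p, K (fst p) (snd p) /\ m - / (INR k + 1) < V (fst p) (snd p)))
    as [H|H]; [exact H|exfalso].
  assert (m <= m - / (INR k + 1)); [|lra].
  apply Hlub; intros v (x & t & Kx & ->).
  apply Rnot_lt_le; intros Hlt; apply H; exists (x, t); auto. }
pose (p := fun k => proj1_sig (constructive_indefinite_description _ (P k))).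
assert (Hp : forall k, K (fst (p k)) (snd (p k)) /\ m - / (INR k + 1) < V (fst (p k)) (snd (p k))).
{ intros k; unfold p; destruct (constructive_indefinite_description _ (P k)) as [q Hq]; exact Hq. }
destruct (bounded_subseq_vec n (fun k => fst (p k)) C) as (phi & x & H1 & H2 & H3).
{ intros k i Hi; now apply (HC _ _ (proj1 (Hp k))). }
destruct (bounded_subseq (fun k => snd (p (phi k))) C) as (psi & t & H4 & H5).
{ intros k; now apply (HC _ _ (proj1 (Hp (phi k)))). }
destruct (Hcl (fun k => fst (p (phi (psi k)))) (fun k => snd (p (phi (psi k)))) x t) as [Kx Hcv].
{ intros k; apply Hp. }
{ exact H2. }
{ split; [|exact H5]; intros i Hi.
  apply (Un_cv_extraction (fun k => fst (p (phi k)) i)); auto. }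
exists x, t; split; [exact Kx|].
assert (m <= V x t).
{ apply le_epsilon; intros e He.
  destruct (Hcv (e / 2)) as [N HN]; [lra|].
  destruct (INR_unbounded (/ (e / 2))) as [N' HN'].
  set (k := (N + N')%nat).
  assert (Hk := HN k ltac:(unfold k; lia)).
  destruct (Hp (phi (psi k))) as [_ Hv].
  assert (/ (INR (phi (psi k)) + 1) < e / 2).
  { rewrite <- (Rinv_inv (e / 2)); apply Rinv_lt_contravar.
    - apply Rmult_lt_0_compat; [apply Rinv_0_lt_compat; lra|pose proof (pos_INR (phi (psi k))); lra].
    - assert (INR N' <= INR (phi (psi k))); [|lra].
      apply le_INR; pose proof (extraction_ge _ H1 (psi k)); pose proof (extraction_ge _ H4 k); unfold k in *; lia. }
  unfold Rdist in Hk; apply Rabs_def2 in Hk; lra. }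
intros y s Ky; apply Rle_trans with (2 := H); apply Hub; exists y, s; auto.
Qed.

Lemma cvg_xt_sqn (n : nat) (u : nat -> Vec) (tau : nat -> R) (x : Vec) (t : R) :
  cvg_xt n u tau x t -> Un_cv (fun k => sqn n (u k)) (sqn n x).
Proof.
intros [H _]; unfold sqn; induction n as [|n IH]; simpl.
- intros e He; exists O; intros; unfold Rdist; rewrite Rminus_diag, Rabs_R0; exact He.
- apply CV_plus; [apply IH; intros; apply H; lia|apply CV_mult; apply H; lia].
Qed.

Lemma cvg_xt_vsub (n : nat) (u : nat -> Vec) (tau : nat -> R) (x : Vec) (t : R) :
  cvg_xt n u tau x t -> Un_cv (fun k => sqn n (vsub (u k) x)) 0.
Proof.
intros H.
assert (E : sqn n (fun _ => 0) = 0) by (unfold sqn; rewrite sum_lt_const; ring).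
rewrite <- E; apply (cvg_xt_sqn n _ tau _ t); split; [|apply H].
intros i Hi e He; destruct (proj1 H i Hi e He) as [N HN]; exists N; intros k Hk.
unfold Rdist, vsub; rewrite Rminus_0_r; now apply HN.
Qed.

Lemma cont_on_xt_seq (n : nat) (P : Vec -> R -> Prop) (f : Vec -> R -> R) u tau x t :
  cont_on_xt n P f -> (forall k, P (u k) (tau k)) -> P x t -> cvg_xt n u tau x t ->
  Un_cv (fun k => f (u k) (tau k)) (f x t).
Proof.
intros Hf Hu Hx Hc e He.
destruct (Hf x t Hx e He) as (d & Hd & H).
destruct (cvg_xt_vsub _ _ _ _ _ Hc (d * d)) as [N1 HN1]; [nra|].
destruct (proj2 Hc d Hd) as [N2 HN2].
exists (N1 + N2)%nat; intros k Hk; unfold Rdist in *; apply H; [apply Hu| |apply HN2; lia].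
specialize (HN1 k ltac:(lia)); rewrite Rminus_0_r in HN1.
apply Rabs_def2 in HN1; rewrite <- vnorm_sqr in HN1.
pose proof (vnorm_nonneg n (vsub (u k) x)); nra.
Qed.

(** * Directional derivatives and conditions at a maximum *)

Lemma derivable_pt_lim_translate (f : R -> R) (s l : R) :
  derivable_pt_lim (fun h => f (s + h)) 0 l <-> derivable_pt_lim f s l.
Proof.
split; intros H e He; destruct (H e He) as [d Hd]; exists d; intros h Hh1 Hh2;
  specialize (Hd h Hh1 Hh2).
- rewrite Rplus_0_l, Rplus_0_r in Hd; exact Hd.
- rewrite Rplus_0_l, Rplus_0_r; exact Hd.
Qed.

Lemma derivable_pt_lim_eq (f g : R -> R) (s l l' : R) :
  derivable_pt_lim f s l -> (forall h, g h = f h) -> l' = l -> derivable_pt_lim g s l'.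
Proof.
intros H E ->; intros e He; destruct (H e He) as [d Hd]; exists d; intros h; rewrite !E; apply Hd.
Qed.

(** Both signs of [y], and y = 0, in one statement, so that increments of unknown sign can be
    treated uniformly. *)
Lemma mean_value (g g' : R -> R) (y : R) :
  (forall c, Rabs c <= Rabs y -> derivable_pt_lim g c (g' c)) ->
  exists c, Rabs c <= Rabs y /\ g y - g 0 = g' c * y.
Proof.
intros H; destruct (Rtotal_order y 0) as [Hy|[->|Hy]].
- destruct (MVT_cor2 g g' y 0 Hy) as (c & E & Hc).
  { intros c Hc; apply H; rewrite !Rabs_left1; lra. }
  exists c; split; [rewrite !Rabs_left1; lra|lra].
- exists 0; split; [lra|ring].
- destruct (MVT_cor2 g g' 0 y Hy) as (c & E & Hc).
  { intros c Hc; apply H; rewrite !Rabs_right; lra. }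
  exists c; split; [rewrite !Rabs_right; lra|lra].
Qed.

Lemma vadd_eq (x y : Vec) (s : R) (z : Vec) : (forall i, z i = x i + s * y i) -> z = vadd x y s.
Proof. intros H; apply functional_extensionality; exact H. Qed.

(** The classical argument that partial derivatives continuous at a point give differentiability
    there: move from x to x + s xi one coordinate at a time and apply the mean value theorem on each
    segment. *)
Lemma directional_derivative (n : nat) (f : Vec -> R) (fi : nat -> Vec -> R) (x xi : Vec) (d0 : R) :
  0 < d0 -> inRn n x -> inRn n xi ->
  (forall y, inRn n y -> vnorm n (vsub y x) < d0 -> forall i, (i < n)%nat ->
     derivable_pt_lim (fun h => f (shift y i h)) 0 (fi i y)) ->
  (forall i, (i < n)%nat -> forall e, 0 < e -> exists d, 0 < d /\
     forall y, inRn n y -> vnorm n (vsub y x) < d -> Rabs (fi i y - fi i x) < e) ->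
  derivable_pt_lim (fun s => f (vadd x xi s)) 0 (sum_lt n (fun i => xi i * fi i x)).
Proof.
intros Hd0 Hx Hxi Hder Hcont.
(* [tr k] keeps the first k coordinates of xi; passing from [tr k] to [tr (S k)] changes coordinate
   k alone. *)
pose (tr := fun k i => if Nat.ltb i k then xi i else 0).
assert (Htr : forall k, (k <= n)%nat -> inRn n (tr k)).
{ intros k Hk i Hi; unfold tr; destruct (Nat.ltb_spec i k); [lia|reflexivity]. }
assert (Hind : forall k, (k <= n)%nat -> derivable_pt_lim (fun s => f (vadd x (tr k) s)) 0
    (sum_lt k (fun i => xi i * fi i x))).
{ induction k as [|k IH]; intros Hk; simpl.
  - apply derivable_pt_lim_eq with (fct_cte (f x)) 0; [apply derivable_pt_lim_const| |reflexivity].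
    intros h; unfold fct_cte; f_equal; symmetry; apply vadd_eq; intros i.
    unfold tr; simpl; destruct (Nat.ltb_spec i 0); [lia|ring].
  - apply derivable_pt_lim_eq with
     (plus_fct (fun s => f (vadd x (tr k) s)) (fun s => f (vadd x (tr (S k)) s) - f (vadd x (tr k) s)))
     (sum_lt k (fun i => xi i * fi i x) + xi k * fi k x);
     [|intros; unfold plus_fct; ring|reflexivity].
    apply derivable_pt_lim_plus; [apply IH; lia|].
    intros e He.
    (* Adding 1 here, and to the norm of xi below, keeps the divisors positive when xi vanishes. *)
    set (C := Rabs (xi k) + 1).
    assert (HC : 0 < C) by (unfold C; pose proof (Rabs_pos (xi k)); lra).
    destruct (Hcont k ltac:(lia) (e / C)) as (d1 & Hd1 & Hc1); [now apply Rdiv_lt_0_compat|].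
    set (m := Rmin d0 d1).
    assert (Hm : 0 < m) by (now apply Rmin_pos).
    set (N := vnorm n xi + 1).
    assert (HN : 0 < N) by (unfold N; pose proof (vnorm_nonneg n xi); lra).
    assert (Hd : 0 < m / N) by now apply Rdiv_lt_0_compat.
    exists (mkposreal _ Hd); intros h Hh1 Hh2; simpl in Hh2.
    rewrite Rplus_0_l.
    assert (Hsh : forall c, shift (shift (vadd x (tr k) h) k c) k = fun c' => shift (vadd x (tr k) h) k (c + c')).
    { intros c; apply functional_extensionality; intros c'; apply functional_extensionality; intros j.
      unfold shift; destruct (Nat.eqb j k); ring. }
    assert (Hin : forall c, inRn n (shift (vadd x (tr k) h) k c)).
    { intros c; rewrite shift_vadd; apply inRn_vadd; [apply inRn_vadd|apply inRn_kron; lia];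
        [exact Hx|apply Htr; lia]. }
    (* Every point of the segment differs from x by at most |h xi_i| in coordinate i, so its
       distance to x is at most |h| |xi|. *)
    assert (Hcl : forall c, Rabs c <= Rabs (h * xi k) ->
       vnorm n (vsub (shift (vadd x (tr k) h) k c) x) < m).
    { intros c Hc.
      apply Rle_lt_trans with (vnorm n (fun i => h * xi i)).
      - apply vnorm_mono; intros i Hi; unfold vsub, shift, vadd, tr.
        destruct (Nat.eqb_spec i k) as [->|Hik].
        + rewrite Nat.ltb_irrefl. replace (x k + h * 0 + c - x k) with c by ring; exact Hc.
        + destruct (Nat.ltb i k).
          * right; f_equal; ring.
          * replace (x i + h * 0 - x i) with 0 by ring; rewrite Rabs_R0; apply Rabs_pos.
      - rewrite vnorm_scal.
        apply Rle_lt_trans with (Rabs h * N).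
        + apply Rmult_le_compat_l; [apply Rabs_pos|unfold N; lra].
        + apply Rmult_lt_reg_r with (/ N); [now apply Rinv_0_lt_compat|].
          replace (Rabs h * N * / N) with (Rabs h) by (field; lra); exact Hh2. }
    destruct (mean_value (fun c => f (shift (vadd x (tr k) h) k c))
       (fun c => fi k (shift (vadd x (tr k) h) k c)) (h * xi k)) as (c & Hc & E).
    { intros c Hc; apply derivable_pt_lim_translate.
      apply derivable_pt_lim_eq with (fun c' => f (shift (shift (vadd x (tr k) h) k c) k c'))
        (fi k (shift (vadd x (tr k) h) k c)).
      - apply Hder; [apply Hin| |lia].
        apply Rlt_le_trans with m; [now apply Hcl|apply Rmin_l].
      - intros c'; rewrite Hsh; reflexivity.
      - reflexivity. }
    replace (shift (vadd x (tr k) h) k (h * xi k)) with (vadd x (tr (S k)) h) in E.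
    2:{ apply functional_extensionality; intros i; unfold shift, vadd, tr.
        destruct (Nat.eqb_spec i k) as [->|Hik].
        - rewrite Nat.ltb_irrefl. destruct (Nat.ltb_spec k (S k)); [ring|lia].
        - destruct (Nat.ltb_spec i (S k)), (Nat.ltb_spec i k); try lia; ring. }
    replace (shift (vadd x (tr k) h) k 0) with (vadd x (tr k) h) in E.
    2:{ apply functional_extensionality; intros i; unfold shift; destruct (Nat.eqb i k); ring. }
    rewrite E.
    replace (f (vadd x (tr (S k)) 0) - f (vadd x (tr k) 0)) with 0.
    2:{ replace (vadd x (tr (S k)) 0) with (vadd x (tr k) 0); [ring|].
        apply functional_extensionality; intros i; unfold vadd; ring. }
    replace ((fi k (shift (vadd x (tr k) h) k c) * (h * xi k) - 0) / h - xi k * fi k x)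
      with (xi k * (fi k (shift (vadd x (tr k) h) k c) - fi k x)) by (field; exact Hh1).
    rewrite Rabs_mult.
    assert (H1 : Rabs (fi k (shift (vadd x (tr k) h) k c) - fi k x) < e / C).
    { apply Hc1; [apply Hin|]. apply Rlt_le_trans with m; [now apply Hcl|apply Rmin_r]. }
    apply Rle_lt_trans with (Rabs (xi k) * (e / C)).
    + apply Rmult_le_compat_l; [apply Rabs_pos|lra].
    + apply Rlt_le_trans with (C * (e / C)).
      * apply Rmult_lt_compat_r; [now apply Rdiv_lt_0_compat|unfold C; lra].
      * right; field; lra. }
apply derivable_pt_lim_eq with (fun s => f (vadd x (tr n) s)) (sum_lt n (fun i => xi i * fi i x));
  [now apply Hind| |reflexivity].
intros h; f_equal; symmetry; apply vadd_eq; intros i; unfold vadd, tr.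
destruct (Nat.ltb_spec i n); [reflexivity|rewrite Hxi by assumption; ring].
Qed.

Lemma max_derivative_zero (g : R -> R) (l d : R) : 0 < d -> derivable_pt_lim g 0 l ->
  (forall s, Rabs s < d -> g s <= g 0) -> l = 0.
Proof.
intros Hd Hg Hmax.
destruct (Req_dec l 0) as [E|E]; [exact E|exfalso].
destruct (Hg (Rabs l)) as [d1 Hd1]; [now apply Rabs_pos_lt|].
set (h := Rmin d d1 / 2).
assert (Hh : 0 < h /\ h < d /\ h < d1).
{ unfold h; pose proof (cond_pos d1); unfold Rmin; destruct (Rle_dec d d1); lra. }
destruct (Rdichotomy _ _ E) as [Hl|Hl].
- assert (H := Hd1 (- h) ltac:(lra) ltac:(rewrite Rabs_Ropp, Rabs_right; lra)).
  rewrite Rplus_0_l, (Rabs_left l) in H by lra; apply Rabs_def2 in H.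
  pose proof (Hmax (- h) ltac:(rewrite Rabs_Ropp, Rabs_right; lra)).
  assert (0 <= (g (- h) - g 0) / - h); [|lra].
  replace ((g (- h) - g 0) / - h) with ((g 0 - g (- h)) * / h) by (field; lra).
  apply Rmult_le_pos; [lra|left; apply Rinv_0_lt_compat; lra].
- assert (H := Hd1 h ltac:(lra) ltac:(rewrite Rabs_right; lra)).
  rewrite Rplus_0_l, (Rabs_right l) in H by lra; apply Rabs_def2 in H.
  pose proof (Hmax h ltac:(rewrite Rabs_right; lra)).
  assert (0 <= (g 0 - g h) * / h); [|unfold Rdiv in H; lra].
  apply Rmult_le_pos; [lra|left; apply Rinv_0_lt_compat; lra].
Qed.

(** At the maximum g' vanishes; if its derivative there were positive, g' would be positive just to
    the right of 0 and g would increase. *)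
Lemma max_second_derivative (g g' : R -> R) (l d : R) : 0 < d ->
  (forall s, Rabs s < d -> derivable_pt_lim g s (g' s)) -> derivable_pt_lim g' 0 l ->
  (forall s, Rabs s < d -> g s <= g 0) -> l <= 0.
Proof.
intros Hd Hg Hg' Hmax.
assert (E : g' 0 = 0).
{ apply (max_derivative_zero g (g' 0) d Hd); [|exact Hmax].
  apply Hg; rewrite Rabs_R0; exact Hd. }
apply Rnot_lt_le; intros Hl.
destruct (Hg' l Hl) as [d1 Hd1].
set (h := Rmin d d1 / 2).
assert (Hh : 0 < h /\ h < d /\ h < d1).
{ unfold h; pose proof (cond_pos d1); unfold Rmin; destruct (Rle_dec d d1); lra. }
destruct (MVT_cor2 g g' 0 h) as (c & Ec & Hc); [lra| |].
{ intros c Hc; apply Hg; rewrite Rabs_right; lra. }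
assert (H := Hd1 c ltac:(lra) ltac:(rewrite Rabs_right; lra)).
rewrite Rplus_0_l, E in H; apply Rabs_def2 in H.
pose proof (Hmax h ltac:(rewrite Rabs_right; lra)).
assert (0 < (g' c - 0) / c) by lra.
assert (0 < g' c).
{ replace (g' c) with ((g' c - 0) / c * c) by (field; lra); apply Rmult_lt_0_compat; lra. }
nra.
Qed.

(** Only difference quotients with negative increments are used, because the maximum may be attained
    at the final time [T]. Comparing them gives an inequality instead of equality of the time
    derivatives. *)
Lemma max_left_derivative (f : R -> R) (T t l L : R) (W : R -> R) :
  0 < t <= T -> deriv_within (fun s => 0 < s <= T) f t l -> derivable_pt_lim W t L ->
  (forall s, 0 < s <= t -> f s - W s <= f t - W t) -> L <= l.
Proof.
intros Ht Hf HW Hmax; apply le_epsilon; intros e He.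
destruct (Hf (e / 2)) as (d1 & Hd1 & H1); [lra|].
destruct (HW (e / 2)) as [d2 H2]; [lra|].
pose proof (cond_pos d2).
set (h := Rmin (Rmin d1 d2) t / 2).
assert (Hh : 0 < h /\ h < d1 /\ h < d2 /\ h < t).
{ unfold h, Rmin; repeat destruct (Rle_dec _ _); lra. }
assert (A1 := H1 (- h) ltac:(lra) ltac:(rewrite Rabs_Ropp, Rabs_right; lra) ltac:(lra)).
assert (A2 := H2 (- h) ltac:(lra) ltac:(rewrite Rabs_Ropp, Rabs_right; lra)).
apply Rabs_def2 in A1; apply Rabs_def2 in A2.
pose proof (Hmax (t + - h) ltac:(lra)).
assert (0 <= (f (t + - h) - f t) / - h - (W (t + - h) - W t) / - h); [|lra].
replace (_ - _) with ((f t - W t - (f (t + - h) - W (t + - h))) * / h) by (field; lra).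
apply Rmult_le_pos; [lra|left; apply Rinv_0_lt_compat; lra].
Qed.

(** Expand the square of | |y| x - |x| y | and divide by |x| |y|; if this product is 0, every term
    x_i y_i vanishes. *)
Lemma cauchy_schwarz (n : nat) (x y : Vec) : dot n x y <= vnorm n x * vnorm n y.
Proof.
pose proof (vnorm_nonneg n x); pose proof (vnorm_nonneg n y).
pose proof (sqn_nonneg n (vadd (fun i => vnorm n y * x i) y (- vnorm n x))) as P.
rewrite sqn_vadd, sqn_scal in P.
assert (E : dot n (fun i => vnorm n y * x i) y = vnorm n y * dot n x y).
{ unfold dot; rewrite <- sum_lt_scal; apply sum_lt_ext; intros; ring. }
rewrite E, <- !vnorm_sqr in P.
destruct (Req_dec (vnorm n x * vnorm n y) 0) as [Z|Z].
- rewrite Z; right; unfold dot; rewrite (sum_lt_ext n _ (fun _ => 0)).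
  + rewrite sum_lt_const; ring.
  + intros i Hi; destruct (Req_dec (x i * y i) 0) as [E0|E0]; [exact E0|exfalso].
    apply Rabs_pos_lt in E0; rewrite Rabs_mult in E0.
    pose proof (Rmult_le_compat _ _ _ _ (Rabs_pos (x i)) (Rabs_pos (y i))
      (coord_le_vnorm n x i Hi) (coord_le_vnorm n y i Hi)); lra.
- assert (0 < vnorm n x * vnorm n y) by (pose proof (Rmult_le_pos _ _ H H0); lra).
  apply Rmult_le_reg_l with (vnorm n x * vnorm n y); nra.
Qed.

Lemma vnorm_triang (n : nat) (x y : Vec) : vnorm n (vadd x y 1) <= vnorm n x + vnorm n y.
Proof.
pose proof (vnorm_nonneg n x); pose proof (vnorm_nonneg n y).
apply Rsqr_incr_0; [|apply vnorm_nonneg|lra].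
unfold Rsqr; rewrite vnorm_sqr, sqn_vadd, <- !vnorm_sqr.
pose proof (cauchy_schwarz n x y); nra.
Qed.

Lemma vnorm_vsub_lower (n : nat) (x y : Vec) : vnorm n x - vnorm n (vsub y x) <= vnorm n y.
Proof.
pose proof (vnorm_triang n y (fun i => - (1) * vsub y x i)) as H.
rewrite vnorm_scal, (Rabs_left (- (1))) in H by lra.
replace (vadd y (fun i => - (1) * vsub y x i) 1) with x in H; [lra|].
apply vadd_eq; intros i; unfold vsub; ring.
Qed.

Lemma vnorm_vsub_upper (n : nat) (x y : Vec) : vnorm n y <= vnorm n x + vnorm n (vsub y x).
Proof.
pose proof (vnorm_triang n x (vsub y x)) as H.
replace (vadd x (vsub y x) 1) with y in H; [exact H|].
apply vadd_eq; intros i; unfold vsub; ring.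
Qed.

Lemma vnorm_vsub_vadd (n : nat) (x u : Vec) (s : R) :
  vnorm n (vsub (vadd x u s) x) = Rabs s * vnorm n u.
Proof.
rewrite <- vnorm_scal; f_equal; apply functional_extensionality; intros i.
unfold vsub, vadd; ring.
Qed.

Lemma derivable_sum_lt (n : nat) (g : nat -> R -> R) (l : nat -> R) (s : R) :
  (forall i, (i < n)%nat -> derivable_pt_lim (g i) s (l i)) ->
  derivable_pt_lim (fun y => sum_lt n (fun i => g i y)) s (sum_lt n l).
Proof.
induction n as [|n IH]; intros H; simpl.
- apply derivable_pt_lim_const.
- apply (derivable_pt_lim_plus (fun y => sum_lt n (fun i => g i y)) (g n)); auto.
Qed.

Lemma derivable_loc (f g : R -> R) (s l d : R) : 0 < d -> derivable_pt_lim f s l ->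
  (forall h, Rabs h < d -> g (s + h) = f (s + h)) -> derivable_pt_lim g s l.
Proof.
intros Hd Hf E e He; destruct (Hf e He) as [d1 Hd1].
assert (Hm : 0 < Rmin d d1) by (apply Rmin_pos; [exact Hd|apply cond_pos]).
exists (mkposreal _ Hm); intros h H1 H2; simpl in H2.
rewrite E by (apply Rlt_le_trans with (1 := H2); apply Rmin_l).
rewrite <- (Rplus_0_r s) at 2; rewrite E by (rewrite Rabs_R0; exact Hd); rewrite Rplus_0_r.
apply Hd1; [exact H1|apply Rlt_le_trans with (1 := H2); apply Rmin_r].
Qed.

(** * Contact from above with a radial function phi(|y|^2) *)

Section SpatialMaximum.

Variables (n : nat) (f : Vec -> R) (fi : nat -> Vec -> R) (fij : nat -> nat -> Vec -> R).
Variables (x : Vec) (d0 : R) (phi phi1 phi2 : R -> R).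
Hypotheses (Hd0 : 0 < d0) (Hx : inRn n x)
  (Hpos : forall y, inRn n y -> vnorm n (vsub y x) < d0 -> 0 < sqn n y)
  (Hfi : forall y, inRn n y -> vnorm n (vsub y x) < d0 -> forall i, (i < n)%nat ->
     derivable_pt_lim (fun h => f (shift y i h)) 0 (fi i y))
  (Hfij : forall y, inRn n y -> vnorm n (vsub y x) < d0 ->
     forall i j, (i < n)%nat -> (j < n)%nat ->
     derivable_pt_lim (fun h => fi j (shift y i h)) 0 (fij i j y))
  (Hfic : forall y, inRn n y -> vnorm n (vsub y x) < d0 -> forall i, (i < n)%nat ->
     forall e, 0 < e -> exists d, 0 < d /\
     forall z, inRn n z -> vnorm n (vsub z y) < d -> Rabs (fi i z - fi i y) < e)
  (Hfijc : forall i j, (i < n)%nat -> (j < n)%nat ->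
     forall e, 0 < e -> exists d, 0 < d /\
     forall z, inRn n z -> vnorm n (vsub z x) < d -> Rabs (fij i j z - fij i j x) < e)
  (Hphi : forall y, 0 < y -> derivable_pt_lim phi y (phi1 y))
  (Hphi1 : forall y, 0 < y -> derivable_pt_lim phi1 y (phi2 y))
  (Hmax : forall y, inRn n y -> vnorm n (vsub y x) < d0 ->
     f y - phi (sqn n y) <= f x - phi (sqn n x)).

Lemma sqn_derivative (u : Vec) (s : R) :
  derivable_pt_lim (fun h => sqn n (vadd x u h)) s (2 * dot n x u + 2 * s * sqn n u).
Proof.
apply derivable_pt_lim_eq with (fun s => sqn n x + 2 * s * dot n x u + s * s * sqn n u)
  (2 * dot n x u + 2 * s * sqn n u); [|intros; apply sqn_vadd|reflexivity].
apply is_derive_Reals; auto_derive; [exact I|ring].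
Qed.

Lemma line_near (u : Vec) : inRn n u -> exists d, 0 < d /\ forall s, Rabs s < d ->
  inRn n (vadd x u s) /\ vnorm n (vsub (vadd x u s) x) < d0.
Proof.
intros Hu; pose proof (vnorm_nonneg n u).
exists (d0 / (vnorm n u + 1)); split; [apply Rdiv_lt_0_compat; lra|].
intros s Hs; split; [now apply inRn_vadd|].
rewrite vnorm_vsub_vadd.
apply Rle_lt_trans with (Rabs s * (vnorm n u + 1)).
- apply Rmult_le_compat_l; [apply Rabs_pos|lra].
- apply Rmult_lt_reg_r with (/ (vnorm n u + 1)); [apply Rinv_0_lt_compat; lra|].
  replace (Rabs s * (vnorm n u + 1) * / (vnorm n u + 1)) with (Rabs s) by (field; lra); exact Hs.
Qed.

Lemma vadd_0 (y u : Vec) : vadd y u 0 = y.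
Proof. apply functional_extensionality; intros i; unfold vadd; ring. Qed.

Lemma x_near : vnorm n (vsub x x) < d0.
Proof.
pose proof (vnorm_vsub_vadd n x x 0) as E; rewrite vadd_0, Rabs_R0 in E; rewrite E; lra.
Qed.

Lemma phi_derivative (u : Vec) (s : R) : 0 < sqn n (vadd x u s) ->
  derivable_pt_lim (fun h => phi (sqn n (vadd x u h))) s
    (phi1 (sqn n (vadd x u s)) * (2 * dot n x u + 2 * s * sqn n u)).
Proof.
intros H; apply (derivable_pt_lim_comp (fun h => sqn n (vadd x u h)) phi).
- apply sqn_derivative.
- now apply Hphi.
Qed.

Lemma max_gradient (i : nat) : (i < n)%nat -> fi i x = 2 * x i * phi1 (sqn n x).
Proof.
intros Hi.
destruct (line_near (kron i) (inRn_kron n i Hi)) as (d & Hd & Hl).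
assert (E : fi i x - phi1 (sqn n x) * (2 * dot n x (kron i) + 2 * 0 * sqn n (kron i)) = 0).
{ apply (max_derivative_zero (fun h => f (vadd x (kron i) h) - phi (sqn n (vadd x (kron i) h))) _ d Hd).
  - apply (derivable_pt_lim_minus (fun h => f (vadd x (kron i) h)) (fun h => phi (sqn n (vadd x (kron i) h)))).
    + apply derivable_pt_lim_eq with (fun h => f (shift x i h)) (fi i x).
      * apply Hfi; [exact Hx|apply x_near|exact Hi].
      * intros h; now rewrite shift_vadd.
      * reflexivity.
    + pose proof (phi_derivative (kron i) 0) as P; rewrite vadd_0 in P.
      apply P, Hpos; [exact Hx|apply x_near].
  - intros s Hs; rewrite vadd_0; apply Hmax; now apply Hl. }
rewrite dot_kron in E by exact Hi; lra.
Qed.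

(** The Hessian at [x] of y |-> f(y) - phi(|y|^2). *)
Definition hess_diff (i j : nat) : R :=
  fij i j x - (2 * kron i j * phi1 (sqn n x) + 4 * x i * x j * phi2 (sqn n x)).

(** The one-variable second-derivative test along the line x + s u. The directional derivative is
    taken twice: of [f] at all points of the line near [x], then of each partial derivative at
    [x]. *)
Lemma max_hessian (u : Vec) : inRn n u -> bil n hess_diff u u <= 0.
Proof.
intros Hu.
destruct (line_near u Hu) as (d & Hd & Hl).
assert (Hr : 0 < sqn n x) by (apply Hpos; [exact Hx|apply x_near]).
assert (E : bil n hess_diff u u =
  sum_lt n (fun i => u i * sum_lt n (fun j => u j * fij j i x))
  - (phi2 (sqn n x) * (2 * dot n x u) * (2 * dot n x u) + phi1 (sqn n x) * (2 * sqn n u))).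
{ unfold bil, hess_diff.
  rewrite (sum_lt_ext n _ (fun i => sum_lt n (fun j => u i * u j * fij i j x)
     + (- 2 * phi1 (sqn n x) * (u i * u i)
     + - 4 * phi2 (sqn n x) * dot n x u * (x i * u i)))).
  2:{ intros i Hi.
      rewrite (sum_lt_ext n _ (fun j => u i * u j * fij i j x +
        (kron i j * (- 2 * phi1 (sqn n x) * u i * u j) +
         (- 4 * phi2 (sqn n x) * u i * x i) * (x j * u j)))) by (intros; ring).
      rewrite !sum_lt_plus, sum_lt_kron, sum_lt_scal by exact Hi; unfold dot; ring. }
  rewrite !sum_lt_plus, !sum_lt_scal, sum_lt_swap.
  rewrite (sum_lt_ext n (fun j => sum_lt n (fun i => u i * u j * fij i j x))
      (fun i => u i * sum_lt n (fun j => u j * fij j i x))).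
  2:{ intros i Hi; rewrite <- sum_lt_scal; apply sum_lt_ext; intros; ring. }
  fold (dot n x u); fold (sqn n u); ring. }
rewrite E.
apply (max_second_derivative
  (fun s => f (vadd x u s) - phi (sqn n (vadd x u s)))
  (fun s => sum_lt n (fun i => u i * fi i (vadd x u s))
      - phi1 (sqn n (vadd x u s)) * (2 * dot n x u + 2 * s * sqn n u)) _ d Hd).
- intros s Hs; destruct (Hl s Hs) as [H1 H2].
  apply (derivable_pt_lim_minus (fun h => f (vadd x u h)) (fun h => phi (sqn n (vadd x u h)))).
  + apply derivable_pt_lim_translate.
    apply derivable_pt_lim_eq with (fun h => f (vadd (vadd x u s) u h))
      (sum_lt n (fun i => u i * fi i (vadd x u s))).
    (* The radius left around the point of the line is chosen so that, by the triangle inequality,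
       the smaller ball stays inside the ball of radius [d0] about [x]. *)
    * apply (directional_derivative n f fi (vadd x u s) u (d0 - vnorm n (vsub (vadd x u s) x)));
        [lra|exact H1|exact Hu| |].
      -- intros y Hy1 Hy2; apply Hfi; [exact Hy1|].
         pose proof (vnorm_triang n (vsub y (vadd x u s)) (vsub (vadd x u s) x)) as Ht.
         replace (vadd (vsub y (vadd x u s)) (vsub (vadd x u s) x) 1) with (vsub y x) in Ht; [lra|].
         apply vadd_eq; intros i; unfold vsub; ring.
      -- intros i Hi; apply Hfic; assumption.
    * intros h; f_equal; apply functional_extensionality; intros i; unfold vadd; ring.
    * reflexivity.
  + apply phi_derivative; now apply Hpos.
- apply (derivable_pt_lim_minus (fun s => sum_lt n (fun i => u i * fi i (vadd x u s)))
    (fun s => phi1 (sqn n (vadd x u s)) * (2 * dot n x u + 2 * s * sqn n u))).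
  + apply (derivable_sum_lt n (fun i s => u i * fi i (vadd x u s))).
    intros i Hi; apply (derivable_pt_lim_scal (fun s => fi i (vadd x u s))).
    apply (directional_derivative n (fi i) (fun j => fij j i) x u d0 Hd0 Hx Hu).
    * intros y H1 H2 j Hj; now apply Hfij.
    * intros j Hj; apply Hfijc; assumption.
  + eapply derivable_pt_lim_eq.
    * apply (derivable_pt_lim_mult (fun s => phi1 (sqn n (vadd x u s)))
       (fun s => 2 * dot n x u + 2 * s * sqn n u)).
      -- apply (derivable_pt_lim_comp (fun h => sqn n (vadd x u h)) phi1).
         ++ apply sqn_derivative.
         ++ apply Hphi1; rewrite vadd_0; exact Hr.
      -- apply is_derive_Reals; auto_derive; [exact I|reflexivity].
    * intros; reflexivity.
    * cbv beta; rewrite vadd_0; ring.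
- intros s Hs; rewrite vadd_0; apply Hmax; now apply Hl.
Qed.

End SpatialMaximum.

(** * Radial diffusion matrices *)

(** The symmetric matrix with eigenvalue a(|x|) in the direction x and al(|x|) on its orthogonal
    complement. *)
Definition radial_mat (n : nat) (al a : R -> R) (x : Vec) (i j : nat) : R :=
  al (vnorm n x) * kron i j
  + (a (vnorm n x) - al (vnorm n x)) * (x i * x j / sqn n x).

Lemma radial_mat_mul (n : nat) (al a : R -> R) (x : Vec) (i : nat) :
  (i < n)%nat -> 0 < sqn n x ->
  sum_lt n (fun j => radial_mat n al a x i j * x j) = a (vnorm n x) * x i.
Proof.
intros Hi Hr.
rewrite (sum_lt_ext n _ (fun j => kron i j * (al (vnorm n x) * x j)
  + (a (vnorm n x) - al (vnorm n x)) * x i / sqn n x * (x j * x j))).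
- rewrite sum_lt_plus, sum_lt_kron, sum_lt_scal by exact Hi; fold (sqn n x); field; lra.
- intros j _; unfold radial_mat; field; lra.
Qed.

Lemma sqn_shift (n : nat) (x : Vec) (i : nat) (h : R) : (i < n)%nat ->
  sqn n (shift x i h) = sqn n x + 2 * h * x i + h * h.
Proof. intros Hi; rewrite shift_vadd, sqn_vadd, dot_kron, sqn_kron by exact Hi; ring. Qed.

Lemma vnorm_shift_derivative (n : nat) (x : Vec) (i : nat) : (i < n)%nat -> 0 < sqn n x ->
  derivable_pt_lim (fun h => vnorm n (shift x i h)) 0 (x i / vnorm n x).
Proof.
intros Hi Hr.
apply derivable_pt_lim_eq with (fun h => sqrt (sqn n x + 2 * h * x i + h * h)) (x i / sqrt (sqn n x)).
- apply is_derive_Reals; auto_derive; [lra|].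
  replace (sqn n x + 2 * 0 * x i + 0 * 0) with (sqn n x) by ring.
  field; apply Rgt_not_eq, sqrt_lt_R0, Hr.
- intros h; rewrite <- sqn_shift by exact Hi; reflexivity.
- reflexivity.
Qed.

Lemma shift_0 (x : Vec) (i : nat) : shift x i 0 = x.
Proof. rewrite shift_vadd; apply vadd_0. Qed.

Lemma comp_vnorm_shift_derivative (n : nat) (g : R -> R) (g' : R) (x : Vec) (i : nat) :
  (i < n)%nat -> 0 < sqn n x -> derivable_pt_lim g (vnorm n x) g' ->
  derivable_pt_lim (fun h => g (vnorm n (shift x i h))) 0 (g' * (x i / vnorm n x)).
Proof.
intros Hi Hr Hg.
apply (derivable_pt_lim_comp (fun h => vnorm n (shift x i h)) g).
- now apply vnorm_shift_derivative.
- now rewrite shift_0.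
Qed.

Lemma coord_shift_derivative (x : Vec) (i j : nat) :
  derivable_pt_lim (fun h => shift x i h j) 0 (kron i j).
Proof.
apply derivable_pt_lim_eq with (fun h => x j + h * kron i j) (kron i j).
- apply is_derive_Reals; auto_derive; [exact I|ring].
- intros h; rewrite shift_vadd; reflexivity.
- reflexivity.
Qed.

Lemma sqn_shift_derivative (n : nat) (x : Vec) (i : nat) : (i < n)%nat ->
  derivable_pt_lim (fun h => sqn n (shift x i h)) 0 (2 * x i).
Proof.
intros Hi; apply derivable_pt_lim_eq with (fun h => sqn n x + 2 * h * x i + h * h) (2 * x i).
- apply is_derive_Reals; auto_derive; [exact I|ring].
- intros h; now apply sqn_shift.
- reflexivity.
Qed.

(** Existence is enough: in the flux this derivative is multiplied by a gradient difference that
    vanishes at the contact point. Only the direction [i] of the row index occurs in a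
    divergence. *)
Lemma radial_mat_derivable (n : nat) (al a : R -> R) (al' a' : R) (x : Vec) (i j : nat) :
  (i < n)%nat -> 0 < sqn n x ->
  derivable_pt_lim al (vnorm n x) al' -> derivable_pt_lim a (vnorm n x) a' ->
  exists l, derivable_pt_lim (fun h => radial_mat n al a (shift x i h) i j) 0 l.
Proof.
intros Hi Hr Hal Ha; unfold radial_mat; eexists.
apply (derivable_pt_lim_plus
  (fun h => al (vnorm n (shift x i h)) * kron i j)
  (fun h => (a (vnorm n (shift x i h)) - al (vnorm n (shift x i h))) *
     (shift x i h i * shift x i h j / sqn n (shift x i h)))).
- apply (derivable_pt_lim_mult (fun h => al (vnorm n (shift x i h))) (fct_cte (kron i j))).
  + now apply comp_vnorm_shift_derivative with (1 := Hi) (2 := Hr) (3 := Hal).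
  + apply derivable_pt_lim_const.
- apply (derivable_pt_lim_mult
   (fun h => a (vnorm n (shift x i h)) - al (vnorm n (shift x i h)))
   (fun h => shift x i h i * shift x i h j / sqn n (shift x i h))).
  + apply (derivable_pt_lim_minus (fun h => a (vnorm n (shift x i h))) (fun h => al (vnorm n (shift x i h)))).
    * now apply comp_vnorm_shift_derivative with (1 := Hi) (2 := Hr) (3 := Ha).
    * now apply comp_vnorm_shift_derivative with (1 := Hi) (2 := Hr) (3 := Hal).
  + apply (derivable_pt_lim_div (fun h => shift x i h i * shift x i h j) (fun h => sqn n (shift x i h))).
    * apply (derivable_pt_lim_mult (fun h => shift x i h i) (fun h => shift x i h j));
        apply coord_shift_derivative.
    * now apply sqn_shift_derivative.
    * rewrite shift_0; lra.
Qed.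

(* The flux of f is split as A (grad f - grad phi) + A grad phi; at a point where the
   gradients agree, the derivatives of A do not contribute to the first part. *)
Lemma radial_flux_derivative (n : nat) (al a : R -> R) (al' a' : R)
  (fi : nat -> Vec -> R) (fij : nat -> nat -> Vec -> R) (phi1 phi2 : R -> R)
  (x : Vec) (i : nat) (dq d0 : R) (Am : Vec -> nat -> nat -> R) :
  0 < d0 -> (i < n)%nat -> 0 < sqn n x ->
  (forall h, Rabs h < d0 -> 0 < sqn n (shift x i h) /\
     forall j, (j < n)%nat -> Am (shift x i h) i j = radial_mat n al a (shift x i h) i j) ->
  derivable_pt_lim al (vnorm n x) al' -> derivable_pt_lim a (vnorm n x) a' ->
  derivable_pt_lim phi1 (sqn n x) (phi2 (sqn n x)) ->
  (forall j, (j < n)%nat -> derivable_pt_lim (fun h => fi j (shift x i h)) 0 (fij i j x)) ->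
  (forall j, (j < n)%nat -> fi j x = 2 * x j * phi1 (sqn n x)) ->
  derivable_pt_lim (fun h => sum_lt n (fun j => Am (shift x i h) i j * fi j (shift x i h))) 0 dq ->
  dq = sum_lt n (fun j => radial_mat n al a x i j * hess_diff n fij x phi1 phi2 i j)
     + (2 * phi1 (sqn n x) * a (vnorm n x)
        + (2 * phi1 (sqn n x) * a' / vnorm n x + 4 * a (vnorm n x) * phi2 (sqn n x)) * (x i * x i)).
Proof.
intros Hd0 Hi Hr HA Hal Ha Hphi Hf Hg Hdq.
assert (Hv : 0 < vnorm n x) by (apply sqrt_lt_R0; exact Hr).
apply (uniqueness_limite _ _ _ _ Hdq).
assert (Hc : derivable_pt_lim (fun h => phi1 (sqn n (shift x i h))) 0 (phi2 (sqn n x) * (2 * x i))).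
{ apply (derivable_pt_lim_comp (fun h => sqn n (shift x i h)) phi1).
  - now apply sqn_shift_derivative.
  - rewrite shift_0; exact Hphi. }
(* The identity for the flux holds only near h = 0, where [Am] is known to be radial. *)
apply derivable_loc with (f := fun h =>
   sum_lt n (fun j => radial_mat n al a (shift x i h) i j *
      (fi j (shift x i h) - 2 * shift x i h j * phi1 (sqn n (shift x i h))))
   + 2 * a (vnorm n (shift x i h)) * (shift x i h i * phi1 (sqn n (shift x i h)))) (1 := Hd0).
2:{ intros h Hh; rewrite Rplus_0_l; destruct (HA h Hh) as [H1 H2].
    rewrite (sum_lt_ext n (fun j => Am (shift x i h) i j * fi j (shift x i h))
      (fun j => radial_mat n al a (shift x i h) i j *
      (fi j (shift x i h) - 2 * shift x i h j * phi1 (sqn n (shift x i h)))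
       + 2 * phi1 (sqn n (shift x i h)) * (radial_mat n al a (shift x i h) i j * shift x i h j))).
    - rewrite sum_lt_plus, sum_lt_scal, radial_mat_mul by assumption; ring.
    - intros j Hj; rewrite H2 by exact Hj; ring. }
apply (derivable_pt_lim_plus
  (fun h => sum_lt n (fun j => radial_mat n al a (shift x i h) i j *
      (fi j (shift x i h) - 2 * shift x i h j * phi1 (sqn n (shift x i h)))))
  (fun h => 2 * a (vnorm n (shift x i h)) * (shift x i h i * phi1 (sqn n (shift x i h))))).
- apply (derivable_sum_lt n (fun j h => radial_mat n al a (shift x i h) i j *
      (fi j (shift x i h) - 2 * shift x i h j * phi1 (sqn n (shift x i h))))).
  intros j Hj.
  destruct (radial_mat_derivable n al a al' a' x i j Hi Hr Hal Ha) as [l Hl].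
  eapply derivable_pt_lim_eq.
  + apply (derivable_pt_lim_mult (fun h => radial_mat n al a (shift x i h) i j)
     (fun h => fi j (shift x i h) - 2 * shift x i h j * phi1 (sqn n (shift x i h)))).
    * exact Hl.
    * apply (derivable_pt_lim_minus (fun h => fi j (shift x i h))
        (fun h => 2 * shift x i h j * phi1 (sqn n (shift x i h)))); [now apply Hf|].
      apply (derivable_pt_lim_mult (fun h => 2 * shift x i h j) (fun h => phi1 (sqn n (shift x i h)))).
      -- apply (derivable_pt_lim_scal (fun h => shift x i h j)), coord_shift_derivative.
      -- exact Hc.
  + intros; reflexivity.
  + cbv beta; rewrite !shift_0, Hg by exact Hj; unfold hess_diff; ring.
- eapply derivable_pt_lim_eq.
  + apply (derivable_pt_lim_mult (fun h => 2 * a (vnorm n (shift x i h)))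
      (fun h => shift x i h i * phi1 (sqn n (shift x i h)))).
    * apply (derivable_pt_lim_scal (fun h => a (vnorm n (shift x i h)))).
      now apply comp_vnorm_shift_derivative with (3 := Ha).
    * apply (derivable_pt_lim_mult (fun h => shift x i h i)
        (fun h => phi1 (sqn n (shift x i h)))); [apply coord_shift_derivative|exact Hc].
  + intros; reflexivity.
  + cbv beta; rewrite !shift_0, kron_eq; field; lra.
Qed.

(** * Comparison with the barrier *)

Section Comparison.

Variables (n : nat) (r0 T : R) (w : Vec -> R -> R) (wx : nat -> Vec -> R -> R)
  (wxx : nat -> nat -> Vec -> R -> R) (wt : Vec -> R -> R).
Hypotheses (hwc : cont_on_xt n (UTbar n r0 T) w)
  (hwx : forall x t, UT n r0 T x t -> forall i, (i < n)%nat ->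
     derivable_pt_lim (fun h => w (shift x i h) t) 0 (wx i x t))
  (hwxx : forall x t, UT n r0 T x t -> forall i j, (i < n)%nat -> (j < n)%nat ->
     derivable_pt_lim (fun h => wx j (shift x i h) t) 0 (wxx i j x t))
  (hwt : forall x t, UT n r0 T x t ->
     deriv_within (fun s => 0 < s <= T) (fun s => w x s) t (wt x t))
  (hwxc : forall i, (i < n)%nat -> cont_on_xt n (UT n r0 T) (wx i))
  (hwxxc : forall i j, (i < n)%nat -> (j < n)%nat -> cont_on_xt n (UT n r0 T) (wxx i j)).

Variables (Am : Vec -> nat -> nat -> R) (b : Vec -> nat -> R) (f0 : Vec -> R -> R).
Hypothesis (hL : forall x t, UT n r0 T x t ->
     exists dq : nat -> R,
       (forall i, (i < n)%nat ->
          derivable_pt_lim (fun h => Aflux Am wx n (shift x i h) t i) 0 (dq i)) /\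
       wt x t - sum_lt n dq - sum_lt n (fun i => b x i * Aflux Am wx n x t i) = f0 x t).

Variables (al a al' a' : R -> R) (C : R).
Hypotheses (hT : 0 < T) (hr0 : 0 < r0)
  (hal : forall r, r0 < r -> 0 < al r /\ derivable_pt_lim al r (al' r))
  (ha : forall r, r0 < r -> 0 < a r /\ derivable_pt_lim a r (a' r))
  (haC : forall r, r0 < r -> a r <= C /\ Rabs (a' r) <= C)
  (hAm : forall x, Udom n r0 x -> forall i j, (i < n)%nat -> (j < n)%nat ->
     Am x i j = radial_mat n al a x i j)
  (hb : forall x, Udom n r0 x -> 1 <= vnorm n x -> Rabs (sum_lt n (fun i => b x i * x i)) <= C).

Lemma C_pos : 0 < C.
Proof. destruct (haC (r0 + 1)), (ha (r0 + 1)); lra. Qed.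

(** With [C] bounding a, |a'| and |b.x|, and p the value of phi, the terms of the operator cost: 2 n
    a phi' at most 2 n C p, 2 a' r phi' at most 2 C p, 4 a r^2 phi'' at most 8 C p, and 2 a phi' b.x
    at most 2 C^2 p. The final 1 is the margin that makes the barrier strict. *)
Definition growth_rate : R := 2 * INR n * C + 10 * C + 2 * C * C + 1.

Lemma growth_rate_pos : 0 < growth_rate.
Proof. unfold growth_rate; pose proof C_pos; pose proof (pos_INR n); nra. Qed.

Lemma UT_near (x : Vec) (t : R) : UT n r0 T x t -> exists d, 0 < d /\
  forall y, inRn n y -> vnorm n (vsub y x) < d -> UT n r0 T y t.
Proof.
intros [[Hx Hv] Ht]; exists (vnorm n x - r0); split; [lra|]; intros y Hy Hd.
split; [split; [exact Hy|]|exact Ht].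
pose proof (vnorm_vsub_lower n x y); lra.
Qed.

Lemma Udom_sqn_pos (x : Vec) : Udom n r0 x -> 0 < sqn n x.
Proof. intros [_ H]; rewrite <- vnorm_sqr; nra. Qed.

Lemma cont_slice (g : Vec -> R -> R) (x : Vec) (t : R) : cont_on_xt n (UT n r0 T) g ->
  UT n r0 T x t -> forall e, 0 < e -> exists d, 0 < d /\
     forall z, inRn n z -> vnorm n (vsub z x) < d -> Rabs (g z t - g x t) < e.
Proof.
intros Hg Hx e He; destruct (Hg x t Hx e He) as (d1 & Hd1 & H1).
destruct (UT_near x t Hx) as (d2 & Hd2 & H2).
exists (Rmin d1 d2); split; [now apply Rmin_pos|]; intros z Hz Hzd.
apply H1.
- apply H2; [exact Hz|]. apply Rlt_le_trans with (1 := Hzd), Rmin_r.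
- apply Rlt_le_trans with (1 := Hzd), Rmin_l.
- rewrite Rminus_diag, Rabs_R0; exact Hd1.
Qed.

(* Both pieces of the barrier, 1/rho and rho, satisfy the two bounds imposed on phi' and phi''. *)
Lemma touching_point (x : Vec) (t d0 : R) (phi phi1 phi2 : R -> R) :
  UT n r0 T x t -> 1 <= vnorm n x -> 0 < d0 ->
  (forall y, 0 < y -> derivable_pt_lim phi y (phi1 y)) ->
  (forall y, 0 < y -> derivable_pt_lim phi1 y (phi2 y)) ->
  (forall y, inRn n y -> vnorm n (vsub y x) < d0 ->
     w y t - phi (sqn n y) <= w x t - phi (sqn n x)) ->
  0 < phi (sqn n x) -> Rabs (phi1 (sqn n x)) * sqn n x <= phi (sqn n x) ->
  phi2 (sqn n x) * (sqn n x * sqn n x) <= 2 * phi (sqn n x) ->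
  wt x t - (growth_rate - 1) * phi (sqn n x) <= f0 x t.
Proof.
intros Hxt HR Hd0 Hphi Hphi1 Hmax Hp Hp1 Hp2.
destruct (UT_near x t Hxt) as (d1 & Hd1 & Hnear1).
pose (d := Rmin d0 d1).
assert (Hd : 0 < d) by now apply Rmin_pos.
assert (Hnear : forall y, inRn n y -> vnorm n (vsub y x) < d -> UT n r0 T y t).
{ intros y Hy Hyd; apply Hnear1; [exact Hy|apply Rlt_le_trans with (1 := Hyd), Rmin_r]. }
pose proof (proj1 (proj1 Hxt)) as Hx.
assert (Hr : 0 < sqn n x) by (apply Udom_sqn_pos, Hxt).
assert (Hgrad : forall i, (i < n)%nat -> wx i x t = 2 * x i * phi1 (sqn n x)).
{ apply (max_gradient n (fun y => w y t) (fun i y => wx i y t) x d phi phi1 Hd Hx).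
  - intros y H1 H2; apply Udom_sqn_pos, (Hnear y H1 H2).
  - intros y H1 H2 i Hi; apply hwx; auto.
  - exact Hphi.
  - intros y H1 H2; apply Hmax; [exact H1|apply Rlt_le_trans with (1 := H2), Rmin_l]. }
pose (D := hess_diff n (fun i j y => wxx i j y t) x phi1 phi2).
assert (Hhess : forall u, inRn n u -> bil n D u u <= 0).
{ apply (max_hessian n (fun y => w y t) (fun i y => wx i y t) (fun i j y => wxx i j y t)
     x d phi phi1 phi2 Hd Hx).
  - intros y H1 H2; apply Udom_sqn_pos, (Hnear y H1 H2).
  - intros y H1 H2 i Hi; apply hwx; auto.
  - intros y H1 H2 i j Hi Hj; apply hwxx; auto.
  - intros y H1 H2 i Hi; apply cont_slice; auto.
  - intros i j Hi Hj; apply cont_slice; auto.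
  - exact Hphi.
  - exact Hphi1.
  - intros y H1 H2; apply Hmax; [exact H1|apply Rlt_le_trans with (1 := H2), Rmin_l]. }
destruct (hL x t Hxt) as (dq & Hdq & HL).
pose (r := vnorm n x).
assert (Hrr : sqn n x = r * r) by (symmetry; apply vnorm_sqr).
assert (Hr1 : 1 <= r) by (unfold r; lra).
assert (Hrr0 : r0 < r) by apply Hxt.
destruct (hal r Hrr0) as [Hal1 Hal2]; destruct (ha r Hrr0) as [Ha1 Ha2].
destruct (haC r Hrr0) as [HaC1 HaC2].
set (p1 := phi1 (sqn n x)) in *; set (p2 := phi2 (sqn n x)) in *; set (p := phi (sqn n x)) in *.
(* Summing the flux derivatives over i, with the squares x_i^2 adding up to r^2, leaves the
   contraction of A with the Hessian difference plus the divergence of the radial flux. *)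
assert (Edq : sum_lt n dq = sum_lt n (fun i => sum_lt n (fun j => radial_mat n al a x i j * D i j))
   + (2 * INR n * p1 * a r + 2 * p1 * a' r * r + 4 * a r * p2 * (r * r))).
{ rewrite (sum_lt_ext n dq (fun i => sum_lt n (fun j => radial_mat n al a x i j * D i j)
     + (2 * p1 * a r + (2 * p1 * a' r / r + 4 * a r * p2) * (x i * x i)))).
  - rewrite !sum_lt_plus, sum_lt_const, sum_lt_scal; fold (sqn n x).
    rewrite Hrr; field; lra.
  - intros i Hi.
    apply (radial_flux_derivative n al a (al' r) (a' r) (fun i y => wx i y t)
      (fun i j y => wxx i j y t) phi1 phi2 x i (dq i) d Am Hd Hi Hr); auto.
    + intros h Hh.
      assert (Hy : UT n r0 T (shift x i h) t).
      { rewrite shift_vadd; apply Hnear; [apply inRn_vadd; [exact Hx|now apply inRn_kron]|].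
        rewrite vnorm_vsub_vadd; fold d.
        replace (vnorm n (kron i)) with 1; [rewrite Rmult_1_r; exact Hh|].
        unfold vnorm; fold (sqn n (kron i)); rewrite sqn_kron by exact Hi.
        symmetry; apply sqrt_1. }
      split; [apply Udom_sqn_pos, Hy|]. intros j Hj; apply hAm; auto; apply Hy.
    + exact (Hdq i Hi). }
assert (HAD : sum_lt n (fun i => sum_lt n (fun j => radial_mat n al a x i j * D i j)) <= 0).
{ apply (radial_contraction_nonpos n D x (al r) (a r)); assumption. }
(* At the contact point grad w is a multiple of x, an eigenvector of A for a(r). *)
assert (Eb : sum_lt n (fun i => b x i * Aflux Am wx n x t i) =
   2 * a r * p1 * sum_lt n (fun i => b x i * x i)).
{ rewrite <- sum_lt_scal; apply sum_lt_ext; intros i Hi.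
  unfold Aflux.
  rewrite (sum_lt_ext n _ (fun j => 2 * p1 * (radial_mat n al a x i j * x j))).
  - rewrite sum_lt_scal, radial_mat_mul by assumption; fold r; ring.
  - intros j Hj; rewrite hAm, Hgrad by (assumption || apply Hxt); ring. }
rewrite Edq, Eb in HL.
pose proof (hb x (proj1 Hxt) HR) as Hbx.
set (bx := sum_lt n (fun i => b x i * x i)) in *.
pose proof C_pos; pose proof (Rabs_pos p1).
rewrite Hrr in Hp1, Hp2.
(* Since r >= 1, the powers of r in the operator are at most those in the assumed bounds on phi' and
   phi''. *)
assert (Hrr1 : 1 <= r * r /\ r <= r * r) by (split; nra).
assert (Q1 : Rabs p1 <= p).
{ apply Rle_trans with (2 := Hp1); rewrite <- (Rmult_1_r (Rabs p1)) at 1.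
  apply Rmult_le_compat_l; lra. }
assert (Q2 : Rabs p1 * r <= p).
{ apply Rle_trans with (2 := Hp1); apply Rmult_le_compat_l; lra. }
(* Here [Hp2] controls p2 r^4; the sign of p2 decides whether the lower power is compared with r^4
   or is already nonpositive. *)
assert (Q3 : p2 * (r * r) <= 2 * p).
{ destruct (Rle_dec p2 0); [nra|].
  assert (1 <= r * r) by nra.
  assert (0 <= p2 * (r * r)) by nra. nra. }
assert (prod : forall u v cu cv, Rabs u <= cu -> Rabs v <= cv -> u * v <= cu * cv).
{ intros u v cu cv Hu Hv; apply Rle_trans with (1 := Rle_abs _); rewrite Rabs_mult.
  apply Rmult_le_compat; auto using Rabs_pos. }
assert (Aa : Rabs (a r) <= C) by (rewrite Rabs_right; lra).
assert (B1 : p1 * a r <= p * C) by (apply prod; assumption).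
assert (B2 : (p1 * r) * a' r <= p * C).
{ apply prod; [rewrite Rabs_mult, (Rabs_right r); lra|assumption]. }
assert (B3 : a r * (p2 * (r * r)) <= C * (2 * p)).
{ destruct (Rle_dec (p2 * (r * r)) 0).
  - apply Rle_trans with 0; nra.
  - apply Rmult_le_compat; lra. }
assert (B4 : (a r * bx) * p1 <= (C * C) * p).
{ apply prod; [rewrite Rabs_mult; apply Rmult_le_compat; auto using Rabs_pos|exact Q1]. }
assert (B1' : INR n * (p1 * a r) <= INR n * (p * C)).
{ apply Rmult_le_compat_l; [apply pos_INR|exact B1]. }
unfold growth_rate.
replace (2 * INR n * p1 * a r) with (2 * (INR n * (p1 * a r))) in HL by ring.
replace (2 * p1 * a' r * r) with (2 * (p1 * r * a' r)) in HL by ring.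
replace (4 * a r * p2 * (r * r)) with (4 * (a r * (p2 * (r * r)))) in HL by ring.
replace (2 * a r * p1 * bx) with (2 * (a r * bx * p1)) in HL by ring.
assert (E : (2 * INR n * C + 10 * C + 2 * C * C + 1 - 1) * p =
  2 * (INR n * (p * C)) + 2 * (p * C) + 4 * (C * (2 * p)) + 2 * (C * C * p)) by ring.
lra.
Qed.

Lemma barrier_derivatives (A0 dl E y : R) : 0 < y ->
  derivable_pt_lim (fun y => E * (A0 / y + dl * y)) y (E * (- A0 / (y * y) + dl)) /\
  derivable_pt_lim (fun y => E * (- A0 / (y * y) + dl)) y (E * (2 * A0 / (y * y * y))).
Proof.
intros Hy; split; apply is_derive_Reals; auto_derive; try (field; lra); repeat split; nra.
Qed.

Section Barrier.

Variables (R0 M eps : R).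
Hypotheses (hR0 : r0 < R0) (hR01 : 1 <= R0) (hM : 0 < M) (heps : 0 < eps)
  (hwM : forall x t, UTbar n r0 T x t -> w x t <= M)
  (hini : forall x, inRn n x -> R0 < vnorm n x -> w x 0 <= eps)
  (hf : forall x t, inRn n x -> R0 < vnorm n x -> 0 <= t <= T -> f0 x t <= eps).

Lemma comparison_pert (dl : R) (x : Vec) (t : R) : 0 < dl ->
  inRn n x -> R0 <= vnorm n x -> 0 <= t <= T ->
  w x t <= eps * (1 + t) + exp (growth_rate * t) * (M * (R0 * R0) / sqn n x + dl * sqn n x).
Proof.
intros Hdl Hx HxR Ht.
set (A0 := M * (R0 * R0)).
pose (W := fun y s => eps * (1 + s) + exp (growth_rate * s) * (A0 / sqn n y + dl * sqn n y)).
apply Rnot_lt_le; intros Hlt; change (W x t < w x t) in Hlt.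
assert (HR2 : 0 < R0 * R0) by nra.
assert (HA0 : 0 < A0) by (apply Rmult_lt_0_compat; assumption).
(* The first entry puts [x] inside the truncated region; the second makes dl rho >= M on the outer
   sphere rho = [Q], so that the maximum cannot lie there. *)
pose (Q := Rmax (sqn n x) (M / dl)).
pose (K := fun y s => inRn n y /\ R0 * R0 <= sqn n y <= Q /\ 0 <= s <= T).
assert (HKU : forall y s, K y s -> UTbar n r0 T y s).
{ intros y s (H1 & H2 & H3); repeat split; auto; try lra.
  pose proof (vnorm_sqr n y); pose proof (vnorm_nonneg n y); nra. }
pose proof growth_rate_pos as HCg.
assert (Hexp : forall s, 0 <= s -> 1 <= exp (growth_rate * s)).
{ intros s Hs; rewrite <- exp_0; destruct Hs as [Hs|<-].
  - left; apply exp_increasing; nra.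
  - right; f_equal; ring. }
assert (HW : forall y s, K y s ->
   eps * (1 + s) + (A0 / sqn n y + dl * sqn n y) <= W y s /\ 0 < A0 / sqn n y /\ 0 < dl * sqn n y).
{ intros y s (H1 & H2 & H3).
  assert (0 < A0 / sqn n y) by (apply Rdiv_lt_0_compat; lra).
  assert (0 < dl * sqn n y) by (apply Rmult_lt_0_compat; lra).
  repeat split; try assumption; unfold W.
  pose proof (Hexp s (proj1 H3)); nra. }
assert (HKx : K x t).
{ split; [exact Hx|split; [split|exact Ht]].
  - rewrite <- vnorm_sqr; nra.
  - apply Rmax_l. }
(* From |z|^2 <= Q follows |z| <= Q + 1, so Q + 1 + T bounds coordinates and times. Since W is
   positive on [K], w - W is at most [M]. *)
destruct (compact_max n K (fun y s => w y s - W y s) (Q + 1 + T) M) as (y & s & HKy & Hmax).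
{ intros z u (H1 & H2 & H3); split.
  - intros i Hi; pose proof (coord_le_vnorm n z i Hi); pose proof (vnorm_sqr n z).
    assert (vnorm n z <= Q + 1) by nra; lra.
  - rewrite Rabs_right; lra. }
{ intros u tau z v HKu Hz Hcv.
  pose proof (cvg_xt_sqn _ _ _ _ _ Hcv) as Hs; destruct Hcv as [Hcx Hct].
  assert (Hlim : forall (q : nat -> R) l lo hi, (forall k, lo <= q k <= hi) -> Un_cv q l -> lo <= l <= hi).
  { intros q l lo hi Hq Hl; split.
    - apply Rle_cv_lim with (Un := fun _ => lo) (Vn := q); [intros; apply Hq| |exact Hl].
      intros e He; exists O; intros; unfold Rdist; rewrite Rminus_diag, Rabs_R0; exact He.
    - apply Rle_cv_lim with (Un := q) (Vn := fun _ => hi); [intros; apply Hq|exact Hl|].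
      intros e He; exists O; intros; unfold Rdist; rewrite Rminus_diag, Rabs_R0; exact He. }
  assert (HKz : K z v).
  { split; [exact Hz|split].
    - apply (Hlim (fun k => sqn n (u k))); [intros k; apply HKu|exact Hs].
    - apply (Hlim tau); [intros k; apply HKu|exact Hct]. }
  split; [exact HKz|].
  apply (CV_minus (fun k => w (u k) (tau k)) (fun k => W (u k) (tau k))).
  - apply (cont_on_xt_seq n (UTbar n r0 T)); auto. split; assumption.
  - assert (Hp : 0 < sqn n z) by (destruct HKz as (_ & ? & _); lra).
    apply (CV_plus (fun k => eps * (1 + tau k))
      (fun k => exp (growth_rate * tau k) * (A0 / sqn n (u k) + dl * sqn n (u k)))).
    + apply (continuity_seq (fun v => eps * (1 + v)) tau v); [reg|exact Hct].
    + apply (CV_mult (fun k => exp (growth_rate * tau k)) (fun k => A0 / sqn n (u k) + dl * sqn n (u k))).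
      * apply (continuity_seq (fun v => exp (growth_rate * v)) tau v); [reg|exact Hct].
      * apply (continuity_seq (fun v => A0 / v + dl * v) (fun k => sqn n (u k)) (sqn n z)); [|exact Hs].
        reg; lra. }
{ intros z v HKz; destruct (HW z v HKz) as (H1 & H2 & H3).
  pose proof (hwM z v (HKU z v HKz)); destruct HKz as (_ & _ & ?); nra. }
{ exists x, t; exact HKx. }
assert (Hpos : 0 < w y s - W y s) by (pose proof (Hmax x t HKx); lra).
destruct (HW y s HKy) as (HW1 & HW2 & HW3).
pose proof (hwM y s (HKU y s HKy)) as HwM.
destruct HKy as (Hy & Hyq & Hs).
assert (Hes : 0 < eps * (1 + s)) by (apply Rmult_lt_0_compat; lra).
(* The maximum is moved off the parabolic boundary: A0/rho = M on the inner sphere, dl rho >= M on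
   the outer one, and w <= eps at time 0. *)
assert (HyR : R0 * R0 < sqn n y).
{ destruct (proj1 Hyq) as [H|H]; [exact H|].
  rewrite <- H in *; replace (A0 / (R0 * R0)) with M in * by (unfold A0; field; lra); lra. }
assert (HyQ : sqn n y < Q).
{ destruct (proj2 Hyq) as [H|H]; [exact H|].
  assert (dl * (M / dl) <= dl * sqn n y).
  { rewrite H; apply Rmult_le_compat_l; [lra|apply Rmax_r]. }
  replace (dl * (M / dl)) with M in * by (field; lra); lra. }
pose proof (vnorm_sqr n y) as Hyy; pose proof (vnorm_nonneg n y) as Hy0.
assert (HyR' : R0 < vnorm n y) by nra.
assert (Hs0 : 0 < s).
{ destruct (proj1 Hs) as [H|H]; [exact H|].
  rewrite <- H in *; pose proof (hini y Hy HyR'); lra. }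
assert (HsQ : vnorm n y < sqrt Q).
{ apply Rsqr_incrst_0; [|exact Hy0|apply sqrt_pos].
  unfold Rsqr; rewrite sqrt_sqrt by lra; lra. }
set (E := exp (growth_rate * s)).
assert (HE : 1 <= E) by (apply Hexp; lra).
assert (HE0 : 0 < A0 / sqn n y + dl * sqn n y) by lra.
(* The term eps (1 + s) is constant in space and is dropped from the test function; it re-enters
   only through the time derivative. The radius keeps the ball between the spheres |z| = R0 and
   |z|^2 = Q. *)
pose proof (touching_point y s (Rmin (vnorm n y - R0) (sqrt Q - vnorm n y))
   (fun v => E * (A0 / v + dl * v)) (fun v => E * (- A0 / (v * v) + dl))
   (fun v => E * (2 * A0 / (v * v * v)))) as HT.
cbv beta in HT.
assert (Hwt : eps + growth_rate * (E * (A0 / sqn n y + dl * sqn n y)) <= wt y s).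
{ apply (max_left_derivative (fun v => w y v) T s (wt y s) _ (fun v => W y v)).
  - lra.
  - apply hwt; repeat split; auto; lra.
  - apply is_derive_Reals; unfold W; auto_derive; [exact I|]; unfold E; ring.
  - intros v Hv; apply (Hmax y v); repeat split; auto; lra. }
assert (Hf0 := hf y s Hy HyR' Hs).
assert (HEp : 0 < E * (A0 / sqn n y + dl * sqn n y)) by (apply Rmult_lt_0_compat; lra).
assert (HT' : wt y s - (growth_rate - 1) * (E * (A0 / sqn n y + dl * sqn n y)) <= f0 y s).
{ apply HT.
  - repeat split; auto; lra.
  - lra.
  - apply Rmin_pos; lra.
  - intros; now apply barrier_derivatives.
  - intros; now apply barrier_derivatives.
  - intros z Hz Hzd.
    pose proof (Rmin_l (vnorm n y - R0) (sqrt Q - vnorm n y)).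
    pose proof (Rmin_r (vnorm n y - R0) (sqrt Q - vnorm n y)).
    pose proof (vnorm_vsub_lower n y z); pose proof (vnorm_vsub_upper n y z).
    pose proof (vnorm_sqr n z); pose proof (vnorm_nonneg n z).
    assert (HQ : sqrt Q * sqrt Q = Q) by (apply sqrt_sqrt; lra).
    assert (HKz : K z s) by (repeat split; auto; try lra; nra).
    pose proof (Hmax z s HKz) as H6; unfold W in H6; fold E in H6; lra.
  - exact HEp.
  - rewrite Rabs_mult, (Rabs_right E) by lra; rewrite Rmult_assoc.
    apply Rmult_le_compat_l; [lra|].
    replace (Rabs (- A0 / (sqn n y * sqn n y) + dl) * sqn n y)
      with (Rabs ((- A0 / (sqn n y * sqn n y) + dl) * sqn n y))
      by (rewrite Rabs_mult, (Rabs_right (sqn n y)) by lra; reflexivity).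
    replace ((- A0 / (sqn n y * sqn n y) + dl) * sqn n y) with (dl * sqn n y - A0 / sqn n y)
      by (field; lra).
    apply Rabs_le; lra.
  - replace (E * (2 * A0 / (sqn n y * sqn n y * sqn n y)) * (sqn n y * sqn n y))
      with (2 * (E * (A0 / sqn n y))) by (field; lra).
    apply Rmult_le_compat_l; [lra|]; apply Rmult_le_compat_l; lra. }
(* With p the spatial test function at [y]: eps + K p <= w_t <= eps + (K - 1) p, contradicting p >
   0. *)
lra.
Qed.

Lemma comparison (x : Vec) (t : R) : inRn n x -> R0 <= vnorm n x -> 0 <= t <= T ->
  w x t <= eps * (1 + T) + exp (growth_rate * T) * (M * (R0 * R0) / sqn n x).
Proof.
intros Hx HxR Ht; apply le_epsilon; intros e He.
pose proof (vnorm_sqr n x) as Hxx.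
assert (Hq : 0 < sqn n x) by nra.
pose proof (exp_pos (growth_rate * t)) as HE.
assert (Hle : exp (growth_rate * t) <= exp (growth_rate * T)).
{ destruct (proj2 Ht) as [H|H]; [|rewrite H; lra].
  left; apply exp_increasing, Rmult_lt_compat_l; [apply growth_rate_pos|exact H]. }
(* At the fixed point (x, t) this choice of dl makes the quadratic term contribute exactly e. *)
assert (Hdl : 0 < e / (exp (growth_rate * t) * sqn n x)).
{ apply Rdiv_lt_0_compat; [exact He|now apply Rmult_lt_0_compat]. }
pose proof (comparison_pert _ x t Hdl Hx HxR Ht) as H.
replace (exp (growth_rate * t) * (M * (R0 * R0) / sqn n x +
    e / (exp (growth_rate * t) * sqn n x) * sqn n x))
  with (exp (growth_rate * t) * (M * (R0 * R0) / sqn n x) + e) in H by (field; lra).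
assert (H1 : 0 <= M * (R0 * R0) / sqn n x).
{ apply Rlt_le, Rdiv_lt_0_compat; [|exact Hq]. apply Rmult_lt_0_compat; [exact hM|nra]. }
pose proof (Rmult_le_compat_r _ _ _ H1 Hle).
assert (eps * (1 + t) <= eps * (1 + T)) by (apply Rmult_le_compat_l; lra).
lra.
Qed.

End Barrier.

Lemma upper_decay :
  (exists M, forall x t, UTbar n r0 T x t -> w x t <= M) ->
  (forall eps, 0 < eps -> exists R1, forall x, Udom n r0 x -> R1 < vnorm n x -> w x 0 <= eps) ->
  (forall eps, 0 < eps -> exists R1, forall x, Udom n r0 x -> R1 < vnorm n x ->
     forall t, 0 <= t <= T -> f0 x t <= eps) ->
  forall eps, 0 < eps -> exists R1, forall x t, inRn n x -> R1 < vnorm n x -> 0 <= t <= T ->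
    w x t <= eps.
Proof.
intros [M HM] Hini Hf eps Heps.
(* With this tolerance the term linear in time is at most eps/2 on [0, T]; the other half is left
   for the decaying term B/|x|^2. *)
assert (He : 0 < eps / (2 * (1 + T))) by (apply Rdiv_lt_0_compat; lra).
destruct (Hini _ He) as [R1 H1]; destruct (Hf _ He) as [R2 H2].
pose (R0 := Rmax (Rmax R1 R2) (Rmax 1 r0) + 1).
assert (HR0 : R1 < R0 /\ R2 < R0 /\ 1 < R0 /\ r0 < R0).
{ unfold R0; pose proof (Rmax_l (Rmax R1 R2) (Rmax 1 r0)); pose proof (Rmax_r (Rmax R1 R2) (Rmax 1 r0)).
  pose proof (Rmax_l R1 R2); pose proof (Rmax_r R1 R2); pose proof (Rmax_l 1 r0); pose proof (Rmax_r 1 r0); lra. }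
destruct HR0 as (HR1 & HR2 & HR3 & HR4).
pose (M' := Rabs M + 1).
assert (HM' : 0 < M' /\ M <= M').
{ unfold M'; pose proof (Rabs_pos M); pose proof (Rle_abs M); lra. }
pose (B := exp (growth_rate * T) * (M' * (R0 * R0))).
assert (HB : 0 < B).
{ apply Rmult_lt_0_compat; [apply exp_pos|apply Rmult_lt_0_compat; [apply HM'|nra]]. }
(* As |x| > R0 > 1, |x|^2 >= |x| > 2 B/eps, hence B/|x|^2 <= eps/2. *)
exists (R0 + 2 * B / eps); intros x t Hx HxR Ht.
assert (HBe : 0 < 2 * B / eps) by (apply Rdiv_lt_0_compat; lra).
assert (Hc : w x t <= eps / (2 * (1 + T)) * (1 + T) + exp (growth_rate * T) * (M' * (R0 * R0) / sqn n x)).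
{ apply comparison; try assumption; try lra.
  - intros y s Hy; pose proof (HM y s Hy); lra.
  - intros y Hy HyR; apply H1; [split|]; lra || assumption.
  - intros y s Hy HyR; apply H2; [split|]; lra || assumption. }
replace (eps / (2 * (1 + T)) * (1 + T)) with (eps / 2) in Hc by (field; lra).
assert (Hq : 2 * B / eps < sqn n x) by (rewrite <- vnorm_sqr; nra).
assert (HBq : exp (growth_rate * T) * (M' * (R0 * R0) / sqn n x) <= eps / 2); [|lra].
replace (exp (growth_rate * T) * (M' * (R0 * R0) / sqn n x)) with (B / sqn n x)
  by (unfold B; field; lra).
apply Rmult_le_reg_r with (sqn n x); [lra|].
replace (B / sqn n x * sqn n x) with (eps / 2 * (2 * B / eps)) by (field; lra).
apply Rmult_le_compat_l; lra.
Qed.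

End Comparison.

(** * Coefficients of the linearised operator *)

(** A class closed under sums, products, inverses of functions bounded below by a positive constant,
    and suitable compositions, so that the eigenvalues of A can be handled by their structure
    without computing derivatives. *)
Definition bounded_C1 (r0 : R) (f : R -> R) : Prop :=
  exists f' C, forall r, r0 < r -> derivable_pt_lim f r (f' r) /\ Rabs (f r) <= C /\ Rabs (f' r) <= C.

Lemma bounded_C1_const (r0 c : R) : bounded_C1 r0 (fun _ => c).
Proof.
exists (fun _ => 0), (Rabs c); intros r _; split; [apply derivable_pt_lim_const|].
rewrite Rabs_R0; split; [lra|apply Rabs_pos].
Qed.

Lemma bounded_C1_ext (r0 : R) (f g : R -> R) : bounded_C1 r0 f ->
  (forall r, r0 < r -> g r = f r) -> bounded_C1 r0 g.
Proof.
intros (f' & C & H) E; exists f', C; intros r Hr; destruct (H r Hr) as (H1 & H2 & H3).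
rewrite E by exact Hr; repeat split; try assumption.
apply derivable_loc with (f := f) (d := r - r0); [lra|exact H1|].
intros h Hh; apply E; apply Rabs_def2 in Hh; lra.
Qed.

Lemma bounded_C1_plus (r0 : R) (f g : R -> R) :
  bounded_C1 r0 f -> bounded_C1 r0 g -> bounded_C1 r0 (fun r => f r + g r).
Proof.
intros (f' & C & H) (g' & D & H'); exists (fun r => f' r + g' r), (C + D); intros r Hr.
destruct (H r Hr) as (H1 & H2 & H3); destruct (H' r Hr) as (H4 & H5 & H6).
split; [now apply (derivable_pt_lim_plus f g)|].
split; (eapply Rle_trans; [apply Rabs_triang|lra]).
Qed.

Lemma bounded_C1_mult (r0 : R) (f g : R -> R) :
  bounded_C1 r0 f -> bounded_C1 r0 g -> bounded_C1 r0 (fun r => f r * g r).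
Proof.
intros (f' & C & H) (g' & D & H'); exists (fun r => f' r * g r + f r * g' r), (2 * (C * D)); intros r Hr.
destruct (H r Hr) as (H1 & H2 & H3); destruct (H' r Hr) as (H4 & H5 & H6).
assert (P : forall u v, Rabs u <= C -> Rabs v <= D -> Rabs (u * v) <= C * D).
{ intros u v Hu Hv; rewrite Rabs_mult; apply Rmult_le_compat; auto using Rabs_pos. }
split; [now apply (derivable_pt_lim_mult f g)|].
pose proof (P _ _ H2 H5); pose proof (P _ _ H3 H5); pose proof (P _ _ H2 H6).
pose proof (Rabs_pos (f r * g r)).
split; [lra|]. eapply Rle_trans; [apply Rabs_triang|lra].
Qed.

Lemma bounded_C1_inv (r0 m : R) (f : R -> R) : 0 < m -> (forall r, r0 < r -> m <= f r) ->
  bounded_C1 r0 f -> bounded_C1 r0 (fun r => / f r).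
Proof.
intros Hm Hf (f' & C & H); exists (fun r => - f' r / (f r * f r)), (/ m + C * (/ m * / m)); intros r Hr.
destruct (H r Hr) as (H1 & H2 & H3); pose proof (Hf r Hr) as Hfm.
assert (HC : 0 <= C) by (pose proof (Rabs_pos (f r)); lra).
assert (Hi : 0 < / m) by now apply Rinv_0_lt_compat.
assert (Hfi : / f r <= / m) by now apply Rinv_le_contravar.
assert (Hfi0 : 0 < / f r) by (apply Rinv_0_lt_compat; lra).
assert (Hmm : 0 < / m * / m) by now apply Rmult_lt_0_compat.
assert (0 <= C * (/ m * / m)) by (apply Rmult_le_pos; lra).
repeat split.
- apply is_derive_Reals; apply is_derive_Reals in H1.
  replace (- f' r / (f r * f r)) with (- f' r / f r ^ 2) by (simpl; rewrite Rmult_1_r; reflexivity).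
  apply (is_derive_inv f); [exact H1|lra].
- rewrite Rabs_right; lra.
- replace (- f' r / (f r * f r)) with (- f' r * (/ f r * / f r)) by (field; lra).
  rewrite Rabs_mult, Rabs_Ropp, (Rabs_right (/ f r * / f r)) by nra.
  assert (/ f r * / f r <= / m * / m) by (apply Rmult_le_compat; lra).
  assert (Rabs (f' r) * (/ f r * / f r) <= C * (/ m * / m)); [|lra].
  apply Rmult_le_compat; try lra; [apply Rabs_pos|nra].
Qed.

Lemma rpow_nonneg (s a : R) : 0 <= rpow s a.
Proof. unfold rpow; destruct (Rle_dec s 0); [lra|left; apply exp_pos]. Qed.

(** For an exponent below 1, s^a is not differentiable at 0, yet s = |c|/r^m never reaches 0 unless
    c = 0, when the function is constantly 0. Otherwise it equals exp(a (ln|c| - m ln r)), which is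
    nonincreasing in r and so bounded by its value at r0; its logarithmic derivative is at most a
    m/r0 in size. *)
Lemma bounded_C1_rpow (r0 c a : R) (m : nat) : 0 < r0 -> 0 < a ->
  bounded_C1 r0 (fun r => rpow (Rabs c / r ^ m) a).
Proof.
intros Hr0 Ha; destruct (Req_dec c 0) as [->|Hc].
- apply bounded_C1_ext with (fun _ => 0); [apply bounded_C1_const|].
  intros r _; rewrite Rabs_R0; unfold rpow, Rdiv; rewrite Rmult_0_l.
  destruct (Rle_dec 0 0); [reflexivity|lra].
- assert (Hc' : 0 < Rabs c) by now apply Rabs_pos_lt.
  apply bounded_C1_ext with (fun r => exp (a * (ln (Rabs c) - INR m * ln r))).
  2:{ intros r Hr; assert (Hm : 0 < r ^ m) by (apply pow_lt; lra).
      unfold rpow; destruct (Rle_dec _ 0) as [Hn|_].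
      - assert (0 < Rabs c / r ^ m) by now apply Rdiv_lt_0_compat. lra.
      - unfold Rpower; rewrite ln_div, ln_pow by lra; reflexivity. }
  set (B := exp (a * (ln (Rabs c) - INR m * ln r0))).
  exists (fun r => exp (a * (ln (Rabs c) - INR m * ln r)) * (a * (- (INR m * / r)))).
  exists (B + B * (a * (INR m * / r0))); intros r Hr.
  assert (HB : 0 < B) by apply exp_pos.
  assert (He : exp (a * (ln (Rabs c) - INR m * ln r)) <= B).
  { assert (a * (ln (Rabs c) - INR m * ln r) <= a * (ln (Rabs c) - INR m * ln r0)) as [H|H].
    - apply Rmult_le_compat_l; [lra|].
      assert (INR m * ln r0 <= INR m * ln r); [|lra].
      apply Rmult_le_compat_l; [apply pos_INR|left; now apply ln_increasing].
    - left; now apply exp_increasing.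
    - unfold B; rewrite H; lra. }
  pose proof (exp_pos (a * (ln (Rabs c) - INR m * ln r))).
  assert (Hir : 0 < / r <= / r0).
  { split; [apply Rinv_0_lt_compat; lra|apply Rinv_le_contravar; lra]. }
  pose proof (pos_INR m).
  assert (H1 : 0 <= INR m * / r <= INR m * / r0).
  { split; [apply Rmult_le_pos; lra|apply Rmult_le_compat_l; lra]. }
  assert (H2 : 0 <= a * (INR m * / r) <= a * (INR m * / r0)).
  { split; [apply Rmult_le_pos; lra|apply Rmult_le_compat_l; lra]. }
  assert (0 <= B * (a * (INR m * / r0))) by (apply Rmult_le_pos; lra).
  repeat split.
  + apply is_derive_Reals; auto_derive; [lra|]; unfold Rminus; ring.
  + rewrite Rabs_right; lra.
  + rewrite Rabs_mult, (Rabs_right (exp _)) by lra.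
    replace (a * - (INR m * / r)) with (- (a * (INR m * / r))) by ring.
    rewrite Rabs_Ropp, (Rabs_right (a * _)) by lra.
    apply Rle_trans with (B * (a * (INR m * / r0))); [|lra].
    apply Rmult_le_compat; lra.
Qed.

Lemma bounded_C1_gfun (d : gdata) (r0 c : R) (m : nat) : 0 < r0 ->
  (forall j, (1 <= j <= gN d)%nat -> 0 < gal d j) ->
  bounded_C1 r0 (fun r => gfun d (Rabs c / r ^ m)).
Proof.
intros Hr0 Hal; unfold gfun; apply bounded_C1_plus; [apply bounded_C1_const|].
assert (H : forall N, (N <= gN d)%nat -> bounded_C1 r0 (fun r =>
    sum_lt N (fun k => ga d (S k) * rpow (Rabs c / r ^ m) (gal d (S k))))).
{ induction N as [|N IH]; intros HN; simpl; [apply bounded_C1_const|].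
  apply bounded_C1_plus; [apply IH; lia|].
  apply bounded_C1_mult; [apply bounded_C1_const|apply bounded_C1_rpow; [exact Hr0|apply Hal; lia]]. }
now apply H.
Qed.

Lemma gfun_lower (d : gdata) (s : R) :
  (forall j, (1 <= j <= gN d)%nat -> 0 <= ga d j) -> ga0 d <= gfun d s.
Proof.
intros H; unfold gfun.
assert (0 <= sum_lt (gN d) (fun k => ga d (S k) * rpow s (gal d (S k)))); [|lra].
apply sum_lt_nonneg; intros i Hi; apply Rmult_le_pos; [apply H; lia|apply rpow_nonneg].
Qed.

(* The data of s |-> (s g(s))' = g(s) + s g'(s), i.e. of G'. *)
Definition gdata_deriv (d : gdata) : gdata :=
  {| ga0 := ga0 d; gN := gN d; ga := fun k => ga d k * (1 + gal d k); gal := gal d |}.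

Lemma gfun_gdata_deriv (d : gdata) (s : R) : 0 < s ->
  gfun (gdata_deriv d) s = gfun d s + gder d s * s.
Proof.
intros Hs; unfold gfun, gder; simpl.
rewrite (Rmult_comm _ s), <- sum_lt_scal, Rplus_assoc, <- sum_lt_plus.
f_equal; apply sum_lt_ext; intros k _.
unfold rpow; destruct (Rle_dec s 0); [lra|].
replace (Rpower s (gal d (S k))) with (Rpower s (gal d (S k) - 1) * s); [ring|].
rewrite <- (Rpower_1 s) at 2 by exact Hs; rewrite <- Rpower_plus; f_equal; ring.
Qed.

(** At s = 0 the two eigenvalues of the Jacobian coincide, in accordance with its value g(0) I at u
    = 0. *)
Lemma gfun_gdata_deriv_0 (d : gdata) : gfun (gdata_deriv d) 0 = gfun d 0.
Proof.
unfold gfun; simpl; f_equal; apply sum_lt_ext; intros k _.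
unfold rpow; destruct (Rle_dec 0 0); [ring|lra].
Qed.

(** * Eigenvalues of the Jacobians and inversion of B *)

Lemma vnorm_ustar (c : R) (n : nat) (x : Vec) : (1 <= n)%nat -> 0 < vnorm n x ->
  vnorm n (ustar c n x) = Rabs c / vnorm n x ^ (n - 1).
Proof.
intros Hn Hv.
assert (Hp : 0 < vnorm n x ^ (n - 1)) by now apply pow_lt.
assert (E : vnorm n x ^ n = vnorm n x * vnorm n x ^ (n - 1)).
{ rewrite tech_pow_Rmult; f_equal; lia. }
replace (ustar c n x) with (fun i => c / vnorm n x ^ n * x i).
- rewrite vnorm_scal, E; unfold Rdiv; rewrite Rabs_mult, Rabs_inv, (Rabs_right (_ * _)).
  + field; lra.
  + apply Rle_ge, Rmult_le_pos; lra.
- apply functional_extensionality; intros i; unfold ustar; rewrite E; field; lra.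
Qed.

(** As u is parallel to x, u u^T/|u| is s times the projection onto x, where s = |u|. This gives
    eigenvalue g(s) across x and g(s) + s g'(s) along it. For c = 0 the projection drops out. *)
Lemma Gjac_ustar (d : gdata) (c : R) (n : nat) (x : Vec) (i j : nat) : (1 <= n)%nat -> 0 < vnorm n x ->
  Gjac d n (ustar c n x) i j =
  let s := Rabs c / vnorm n x ^ (n - 1) in
  gfun d s * kron i j + (gfun (gdata_deriv d) s - gfun d s) * (x i * x j / sqn n x).
Proof.
intros Hn Hv; cbv zeta; unfold Gjac.
assert (Es := vnorm_ustar c n x Hn Hv).
assert (Hp : 0 < vnorm n x ^ (n - 1)) by now apply pow_lt.
assert (E : vnorm n x ^ n = vnorm n x * vnorm n x ^ (n - 1)).
{ rewrite tech_pow_Rmult; f_equal; lia. }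
rewrite Es; set (s := Rabs c / vnorm n x ^ (n - 1)) in *.
assert (Hs : 0 <= s) by (rewrite <- Es; apply vnorm_nonneg).
destruct (Rle_dec s 0) as [H|H].
- replace s with 0 by lra; rewrite gfun_gdata_deriv_0; ring.
- rewrite gfun_gdata_deriv by lra; unfold ustar; rewrite E, <- vnorm_sqr.
  (* The sign of c disappears in u_i u_j, so c^2 may be expressed through s. *)
  assert (Ecs : c * c = (s * vnorm n x ^ (n - 1)) * (s * vnorm n x ^ (n - 1))).
  { unfold s; replace (Rabs c / vnorm n x ^ (n - 1) * vnorm n x ^ (n - 1)) with (Rabs c) by (field; lra).
    pose proof (Rsqr_abs c) as E2; unfold Rsqr in E2; exact E2. }
  replace (gder d s * (c * x i / (vnorm n x * vnorm n x ^ (n - 1)))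
     * (c * x j / (vnorm n x * vnorm n x ^ (n - 1))) / s)
   with (gder d s * (c * c) * (x i * x j) / (vnorm n x * vnorm n x * (vnorm n x ^ (n - 1) * vnorm n x ^ (n - 1))) / s)
   by (field; repeat split; lra).
  rewrite Ecs; field; repeat split; lra.
Qed.

(** Contracting B A = I with x on the left gives la x^T A = x^T; inserting this into the rows of B A
    = I determines every entry of A. *)
Lemma radial_inverse (n : nat) (Bm Am : nat -> nat -> R) (x : Vec) (be la : R) :
  0 < sqn n x -> 0 < be -> 0 < la ->
  (forall i j, (i < n)%nat -> (j < n)%nat ->
     Bm i j = be * kron i j + (la - be) * (x i * x j / sqn n x)) ->
  (forall i k, (i < n)%nat -> (k < n)%nat -> sum_lt n (fun j => Bm i j * Am j k) = kron i k) ->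
  forall i k, (i < n)%nat -> (k < n)%nat ->
    Am i k = / be * kron i k + (/ la - / be) * (x i * x k / sqn n x).
Proof.
intros Hr Hbe Hla HB HA.
assert (H1 : forall i k, (i < n)%nat -> (k < n)%nat ->
   be * Am i k + (la - be) * x i / sqn n x * sum_lt n (fun j => x j * Am j k) = kron i k).
{ intros i k Hi Hk; rewrite <- (HA i k Hi Hk).
  rewrite (sum_lt_ext n (fun j => Bm i j * Am j k) (fun j => kron i j * (be * Am j k)
     + (la - be) * x i / sqn n x * (x j * Am j k))).
  - now rewrite sum_lt_plus, sum_lt_kron, sum_lt_scal.
  - intros j Hj; rewrite HB by assumption; field; lra. }
assert (H2 : forall k, (k < n)%nat -> la * sum_lt n (fun j => x j * Am j k) = x k).
{ intros k Hk; rewrite <- (sum_lt_kron n k x Hk).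
  rewrite (sum_lt_ext n (fun i => kron k i * x i) (fun i => be * (x i * Am i k)
     + ((la - be) / sqn n x * sum_lt n (fun j => x j * Am j k)) * (x i * x i))).
  - rewrite sum_lt_plus, !sum_lt_scal; fold (sqn n x); field; lra.
  - intros i Hi; rewrite kron_sym, <- (H1 i k Hi Hk); field; lra. }
intros i k Hi Hk; pose proof (H1 i k Hi Hk) as H3; pose proof (H2 k Hk) as H4.
rewrite <- H3, <- H4; field; lra.
Qed.

(** * Positivity and bounds along the stationary profile *)

Lemma deriv_within_interior (f : R -> R) (r0 r l : R) : r0 < r ->
  deriv_within (fun y => r0 <= y) f r l -> derivable_pt_lim f r l.
Proof.
intros Hr H e He; destruct (H e He) as (d & Hd & Hd').
assert (Hm : 0 < Rmin d (r - r0)) by (apply Rmin_pos; lra).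
exists (mkposreal _ Hm); intros h H1 H2; simpl in H2.
pose proof (Rmin_l d (r - r0)); pose proof (Rmin_r d (r - r0)).
apply Hd'; [exact H1|lra|]; apply Rabs_def2 in H2; lra.
Qed.

Lemma increasing_pos (f f' : R -> R) : cont_on_R (fun s => 0 <= s <= 1) f -> f 0 = 0 ->
  (forall s, 0 < s < 1 -> derivable_pt_lim f s (f' s)) -> (forall s, 0 < s < 1 -> 0 < f' s) ->
  forall s, 0 < s < 1 -> 0 < f s.
Proof.
intros Hc H0 Hd Hp.
assert (Hinc : forall y s, 0 < y -> y < s -> s < 1 -> f y < f s).
{ intros y s H1 H2 H3; destruct (MVT_cor2 f f' y s H2) as (c & E & Hcc).
  - intros c Hcc; apply Hd; lra.
  - pose proof (Hp c ltac:(lra)); nra. }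
intros s Hs.
(* At 0 only continuity is available. It yields f(s/2) >= 0 in the limit; strictness comes from s/2
   < s inside the open interval. *)
apply Rle_lt_trans with (f (s / 2)); [|apply Hinc; lra].
apply le_epsilon; intros e He.
destruct (Hc 0 ltac:(lra) e He) as (d & Hd0 & H).
pose proof (Rmin_l d (s / 2)); pose proof (Rmin_r d (s / 2)).
assert (0 < Rmin d (s / 2)) by (apply Rmin_pos; lra).
set (y := Rmin d (s / 2) / 2) in *.
assert (A := H y ltac:(unfold y; lra) ltac:(rewrite Rminus_0_r, Rabs_right; unfold y; lra)).
rewrite H0, Rminus_0_r in A; apply Rabs_def2 in A.
pose proof (Hinc y (s / 2) ltac:(unfold y; lra) ltac:(unfold y; lra) ltac:(lra)); lra.
Qed.

(** Extreme values on the compact interval [slo, sup]. The derivative [dF] is given pointwise, so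
    its bound goes through the explicit quotient with which uniqueness of derivatives identifies
    it. *)
Lemma Ffun_bounds (pc dpc f df dF : R -> R) (slo sup : R) : 0 < slo -> slo <= sup -> sup < 1 ->
  (forall s, 0 < s < 1 -> derivable_pt_lim f s (df s) /\ continuity_pt df s) ->
  (forall s, 0 < s < 1 -> derivable_pt_lim pc s (dpc s) /\ continuity_pt dpc s) ->
  (forall s, 0 < s < 1 -> 0 < pc s) -> (forall s, 0 < s < 1 -> 0 < f s) ->
  (forall s, 0 < s < 1 -> derivable_pt_lim (Ffun pc f) s (dF s)) ->
  exists m C, 0 < m /\ forall s, slo <= s <= sup ->
    m <= Ffun pc f s /\ Rabs (Ffun pc f s) <= C /\ Rabs (dF s) <= C.
Proof.
intros Hlo Hls Hsup Hf Hpc Hpcp Hfp HF.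
assert (Hcont : forall g l s, derivable_pt_lim g s l -> continuity_pt g s).
{ intros g l s H; apply derivable_continuous_pt; exists l; exact H. }
assert (EdF : forall s, 0 < s < 1 -> dF s = - (dpc s * f s + pc s * df s) / (pc s * f s) ^ 2).
{ intros s Hs; apply (uniqueness_limite _ _ _ _ (HF s Hs)).
  apply is_derive_Reals, (is_derive_inv (fun s => pc s * f s)).
  - apply is_derive_Reals, (derivable_pt_lim_mult pc f); [apply Hpc|apply Hf]; exact Hs.
  - pose proof (Hpcp s Hs); pose proof (Hfp s Hs); nra. }
destruct (continuity_ab_min (Ffun pc f) slo sup Hls) as (s1 & Hs1 & Hs1').
{ intros s Hs; apply (Hcont _ (dF s)), HF; lra. }
destruct (continuity_ab_maj (Ffun pc f) slo sup Hls) as (s2 & Hs2 & _).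
{ intros s Hs; apply (Hcont _ (dF s)), HF; lra. }
pose (h := fun s => Rabs (- (dpc s * f s + pc s * df s) / (pc s * f s * (pc s * f s)))).
destruct (continuity_ab_maj h slo sup Hls) as (s3 & Hs3 & _).
{ intros s Hs; unfold h; assert (Hs01 : 0 < s < 1) by lra.
  assert (C1 := Hcont _ _ _ (proj1 (Hf s Hs01))); assert (C2 := Hcont _ _ _ (proj1 (Hpc s Hs01))).
  assert (C3 := proj2 (Hf s Hs01)); assert (C4 := proj2 (Hpc s Hs01)).
  assert (C5 : continuity_pt (fun s => pc s * f s) s) by now apply (continuity_pt_mult pc f).
  apply (continuity_pt_comp (fun s => - (dpc s * f s + pc s * df s) / (pc s * f s * (pc s * f s))) Rabs).
  - apply (continuity_pt_div (fun s => - (dpc s * f s + pc s * df s)) (fun s => pc s * f s * (pc s * f s))).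
    + apply (continuity_pt_opp (fun s => dpc s * f s + pc s * df s)).
      apply (continuity_pt_plus (fun s => dpc s * f s) (fun s => pc s * df s)).
      * now apply (continuity_pt_mult dpc f).
      * now apply (continuity_pt_mult pc df).
    + now apply (continuity_pt_mult (fun s => pc s * f s) (fun s => pc s * f s)).
    + pose proof (Rmult_lt_0_compat _ _ (Hpcp s Hs01) (Hfp s Hs01)); nra.
  - apply Rcontinuity_abs. }
assert (HFp : forall s, slo <= s <= sup -> 0 < Ffun pc f s).
{ intros s Hs; apply Rinv_0_lt_compat, Rmult_lt_0_compat; [apply Hpcp|apply Hfp]; lra. }
pose proof (HFp s1 Hs1').
(* The minimum of F serves below; the sum of the maxima of F and |F'| bounds both at once. *)
exists (Ffun pc f s1), (Rabs (Ffun pc f s2) + h s3); split; [assumption|].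
intros s Hs; pose proof (HFp s Hs).
assert (0 <= h s3) by apply Rabs_pos; pose proof (Rabs_pos (Ffun pc f s2)).
pose proof (Hs2 s Hs); pose proof (Rle_abs (Ffun pc f s2)).
repeat split.
- now apply Hs1.
- rewrite Rabs_right; lra.
- pose proof (Hs3 s Hs) as Hh; rewrite EdF by lra; unfold h at 1 in Hh; simpl; rewrite Rmult_1_r; lra.
Qed.

Lemma bounded_C1_comp (r0 slo sup C D : R) (F dF S S' : R -> R) :
  (forall r, r0 < r -> slo <= S r <= sup) ->
  (forall s, slo <= s <= sup -> derivable_pt_lim F s (dF s) /\ Rabs (F s) <= C /\ Rabs (dF s) <= C) ->
  (forall r, r0 < r -> derivable_pt_lim S r (S' r) /\ Rabs (S' r) <= D) ->
  bounded_C1 r0 (fun r => F (S r)).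
Proof.
intros HS HF HS'; exists (fun r => dF (S r) * S' r), (C + C * D); intros r Hr.
destruct (HF (S r) (HS r Hr)) as (H1 & H2 & H3); destruct (HS' r Hr) as (H4 & H5).
pose proof (Rabs_pos (F (S r))); pose proof (Rabs_pos (S' r)).
assert (0 <= C * D) by (apply Rmult_le_pos; lra).
split; [now apply (derivable_pt_lim_comp S F)|split; [lra|]].
rewrite Rabs_mult.
assert (Rabs (dF (S r)) * Rabs (S' r) <= C * D) by (apply Rmult_le_compat; auto using Rabs_pos).
lra.
Qed.

Theorem theorem5p8
  (n : nat) (hn : (2 <= n)%nat)
  (* g_1, g_2 *)
  (d1 d2 : gdata) (hd1 : gdata_ok d1) (hd2 : gdata_ok d2)
  (* f_1, f_2 with derivatives df1, df2 *)
  (f1 f2 df1 df2 : R -> R)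
  (hf1c : cont_on_R (fun s => 0 <= s <= 1) f1)
  (hf2c : cont_on_R (fun s => 0 <= s <= 1) f2)
  (hf1d : forall s, 0 < s < 1 -> derivable_pt_lim f1 s (df1 s) /\ continuity_pt df1 s)
  (hf2d : forall s, 0 < s < 1 -> derivable_pt_lim f2 s (df2 s) /\ continuity_pt df2 s)
  (hf10 : f1 0 = 0) (hf21 : f2 1 = 0)
  (hdf1 : forall s, 0 < s < 1 -> 0 < df1 s)
  (hdf2 : forall s, 0 < s < 1 -> df2 s < 0)
  (* p_c' with derivative dpc *)
  (pc dpc : R -> R)
  (hpcd : forall s, 0 < s < 1 -> derivable_pt_lim pc s (dpc s) /\ continuity_pt dpc s)
  (hpcpos : forall s, 0 < s < 1 -> 0 < pc s)
  (* F_1', F_2' *)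
  (dF1 dF2 : R -> R)
  (hdF1 : forall s, 0 < s < 1 -> derivable_pt_lim (Ffun pc f1) s (dF1 s))
  (hdF2 : forall s, 0 < s < 1 -> derivable_pt_lim (Ffun pc f2) s (dF2 s))
  (* parameters *)
  (r0 c1 c2 s0 : R) (hr0 : 0 < r0) (hc : c1 ^ 2 + c2 ^ 2 > 0) (hs0 : 0 < s0 < 1)
  (* S-hat *)
  (Shat : R -> R)
  (hSode : forall r, r0 <= r ->
     deriv_within (fun y => r0 <= y) Shat r (ode_rhs d1 d2 pc f1 f2 c1 c2 n r (Shat r)))
  (hSinit : Shat r0 = s0)
  (slo sup : R) (hslo : 0 < slo) (hsup : sup < 1)
  (hSbd : forall r, r0 <= r -> slo <= Shat r <= sup)
  (* A = B^{-1} on the closure of U *)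
  (Am : Vec -> nat -> nat -> R)
  (hA : forall x, Ubar n r0 x -> forall i k, (i < n)%nat -> (k < n)%nat ->
     sum_lt n (fun j => Bmat d1 d2 pc f1 f2 c1 c2 n Shat x i j * Am x j k) = kron i k)
  (* data *)
  (T : R) (hT : 0 < T)
  (f0 : Vec -> R -> R) (hf0 : cont_on_xt n (UTbar n r0 T) f0)
  (w0 : Vec -> R) (hw0 : cont_on_x n (Ubar n r0) w0)
  (Gb : Vec -> R -> R) (hGb : cont_on_xt n (fun x t => Gam n r0 x /\ 0 <= t <= T) Gb)
  (* w and its derivatives: w in C^{2,1}_{x,t}(U_T) /\ C(closure U_T) *)
  (w : Vec -> R -> R) (wx : nat -> Vec -> R -> R) (wxx : nat -> nat -> Vec -> R -> R)
  (wt : Vec -> R -> R)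
  (hwc : cont_on_xt n (UTbar n r0 T) w)
  (hwx : forall x t, UT n r0 T x t -> forall i, (i < n)%nat ->
     derivable_pt_lim (fun h => w (shift x i h) t) 0 (wx i x t))
  (hwxx : forall x t, UT n r0 T x t -> forall i j, (i < n)%nat -> (j < n)%nat ->
     derivable_pt_lim (fun h => wx j (shift x i h) t) 0 (wxx i j x t))
  (hwt : forall x t, UT n r0 T x t ->
     deriv_within (fun s => 0 < s <= T) (fun s => w x s) t (wt x t))
  (hwxc : forall i, (i < n)%nat -> cont_on_xt n (UT n r0 T) (wx i))
  (hwxxc : forall i j, (i < n)%nat -> (j < n)%nat -> cont_on_xt n (UT n r0 T) (wxx i j))
  (hwtc : cont_on_xt n (UT n r0 T) wt)
  (* w bounded *)
  (hwb : exists M, forall x t, UTbar n r0 T x t -> Rabs (w x t) <= M)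
  (* L w = f0 in U_T, with L w = w_t - div(A grad w) - b . (A grad w) *)
  (hL : forall x t, UT n r0 T x t ->
     exists dq : nat -> R,
       (forall i, (i < n)%nat ->
          derivable_pt_lim (fun h => Aflux Am wx n (shift x i h) t i) 0 (dq i)) /\
       wt x t - sum_lt n dq
       - sum_lt n (fun i => bvec d1 d2 dF1 dF2 c1 c2 n Shat x i * Aflux Am wx n x t i)
       = f0 x t)
  (hinit : forall x, Udom n r0 x -> w x 0 = w0 x)
  (hbdry : forall x t, Gam n r0 x -> 0 < t <= T -> w x t = Gb x t)
  (* decay of the data *)
  (hw0lim : forall eps, 0 < eps -> exists R1, forall x, Ubar n r0 x -> R1 < vnorm n x ->
     Rabs (w0 x) <= eps)
  (hf0lim : forall eps, 0 < eps -> exists R1, forall x, Ubar n r0 x -> R1 < vnorm n x ->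
     forall t, 0 <= t <= T -> Rabs (f0 x t) <= eps) :
  forall eps, 0 < eps -> exists R1, forall r, R1 < r ->
    forall x t, inRn n x -> vnorm n x = r -> 0 <= t <= T -> Rabs (w x t) <= eps.
Proof.
assert (Hls : slo <= sup) by (pose proof (hSbd r0 (Rle_refl _)); lra).
assert (Hf1p : forall s, 0 < s < 1 -> 0 < f1 s).
{ apply (increasing_pos f1 df1); auto; apply hf1d. }
assert (Hf2p : forall s, 0 < s < 1 -> 0 < f2 s).
(* The reflection y -> 1 - y turns the decreasing function f2 with f2(1) = 0 into an increasing one
   vanishing at 0. *)
{ intros s Hs; replace s with (1 - (1 - s)) by ring.
  apply (increasing_pos (fun y => f2 (1 - y)) (fun y => - df2 (1 - y))); try lra.
  - intros y Hy e He; destruct (hf2c (1 - y) ltac:(lra) e He) as (d & Hd & H).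
    exists d; split; [exact Hd|]; intros z Hz Hzy; apply H; [lra|].
    replace (1 - z - (1 - y)) with (- (z - y)) by ring; rewrite Rabs_Ropp; exact Hzy.
  - now rewrite Rminus_0_r.
  - intros y Hy; apply derivable_pt_lim_eq with (comp f2 (fun z => 1 - z)) (df2 (1 - y) * -1);
      [|reflexivity|ring].
    apply derivable_pt_lim_comp; [apply is_derive_Reals; auto_derive; [exact I|ring]|].
    apply hf2d; lra.
  - intros y Hy; pose proof (hdf2 (1 - y) ltac:(lra)); lra. }
destruct (Ffun_bounds pc dpc f1 df1 dF1 slo sup) as (m1 & C1 & Hm1 & HF1); auto.
destruct (Ffun_bounds pc dpc f2 df2 dF2 slo sup) as (m2 & C2 & Hm2 & HF2); auto.
destruct hd1 as (hd10 & hd1a & hd1al & _); destruct hd2 as (hd20 & hd2a & hd2al & _).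
pose (s1 := fun r => Rabs c1 / r ^ (n - 1)); pose (s2 := fun r => Rabs c2 / r ^ (n - 1)).
pose proof (bounded_C1_gfun d1 r0 c1 (n - 1) hr0 hd1al) as Bg1.
pose proof (bounded_C1_gfun d2 r0 c2 (n - 1) hr0 hd2al) as Bg2.
pose proof (bounded_C1_gfun (gdata_deriv d1) r0 c1 (n - 1) hr0 hd1al) as Bh1.
pose proof (bounded_C1_gfun (gdata_deriv d2) r0 c2 (n - 1) hr0 hd2al) as Bh2.
pose proof Bg1 as (g1' & G1 & HG1).
pose proof Bg2 as (g2' & G2 & HG2).
assert (HrI : forall r, r0 < r -> 0 < / r ^ (n - 1) <= / r0 ^ (n - 1)).
{ intros r Hr; assert (0 < r0 ^ (n - 1)) by now apply pow_lt.
  assert (r0 ^ (n - 1) <= r ^ (n - 1)) by (apply pow_incr; lra).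
  split; [apply Rinv_0_lt_compat; lra|apply Rinv_le_contravar; lra]. }
(* Boundedness of g_i together with r^(1-n) <= r0^(1-n) bounds the right-hand side of the ODE, hence
   the derivative of [Shat]. *)
assert (HGsc : forall d c G, (forall r, r0 < r -> Rabs (gfun d (Rabs c / r ^ (n - 1))) <= G) ->
   forall r, r0 < r -> Rabs (Gsc d (c / r ^ (n - 1))) <= G * (Rabs c * / r0 ^ (n - 1))).
{ intros d c G HG r Hr; destruct (HrI r Hr) as [H1 H2]; unfold Gsc.
  replace (Rabs (c / r ^ (n - 1))) with (Rabs c / r ^ (n - 1)).
  - rewrite Rabs_mult; apply Rmult_le_compat; try apply Rabs_pos; [now apply HG|].
    unfold Rdiv; rewrite Rabs_mult, (Rabs_right (/ _)) by lra.
    apply Rmult_le_compat_l; [apply Rabs_pos|exact H2].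
  - unfold Rdiv; rewrite Rabs_mult, (Rabs_right (/ _)) by lra; reflexivity. }
pose (D1 := G1 * (Rabs c1 * / r0 ^ (n - 1))); pose (D2 := G2 * (Rabs c2 * / r0 ^ (n - 1))).
assert (HS' : forall r, r0 < r ->
   derivable_pt_lim Shat r (ode_rhs d1 d2 pc f1 f2 c1 c2 n r (Shat r)) /\
   Rabs (ode_rhs d1 d2 pc f1 f2 c1 c2 n r (Shat r)) <= D2 * C2 + D1 * C1).
{ intros r Hr; split; [apply deriv_within_interior with r0; [exact Hr|apply hSode; lra]|].
  unfold ode_rhs, Rminus; eapply Rle_trans; [apply Rabs_triang|]; rewrite Rabs_Ropp, !Rabs_mult.
  destruct (HF1 (Shat r) (hSbd r ltac:(lra))) as (_ & A1 & _).
  destruct (HF2 (Shat r) (hSbd r ltac:(lra))) as (_ & A2 & _).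
  apply Rplus_le_compat; apply Rmult_le_compat; try apply Rabs_pos; try assumption.
  - apply (HGsc d2 c2 G2); [intros; now apply HG2|exact Hr].
  - apply (HGsc d1 c1 G1); [intros; now apply HG1|exact Hr]. }
assert (BF1 : bounded_C1 r0 (fun r => Ffun pc f1 (Shat r))).
{ apply (bounded_C1_comp r0 slo sup C1 (D2 * C2 + D1 * C1) (Ffun pc f1) dF1 Shat
    (fun r => ode_rhs d1 d2 pc f1 f2 c1 c2 n r (Shat r))); [intros; apply hSbd; lra| |exact HS'].
  intros s Hs; destruct (HF1 s Hs); split; [apply hdF1; lra|assumption]. }
assert (BF2 : bounded_C1 r0 (fun r => Ffun pc f2 (Shat r))).
{ apply (bounded_C1_comp r0 slo sup C2 (D2 * C2 + D1 * C1) (Ffun pc f2) dF2 Shat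
    (fun r => ode_rhs d1 d2 pc f1 f2 c1 c2 n r (Shat r))); [intros; apply hSbd; lra| |exact HS'].
  intros s Hs; destruct (HF2 s Hs); split; [apply hdF2; lra|assumption]. }
(* Both eigenvalues of B have this form: with the data of g_i across x, and with those of (s g_i)'
   along x. The constant coefficients agree, so [m] is a lower bound for both. *)
pose (coef := fun (e1 e2 : gdata) r =>
   Ffun pc f1 (Shat r) * gfun e1 (s1 r) + Ffun pc f2 (Shat r) * gfun e2 (s2 r)).
pose (be := coef d1 d2); pose (la := coef (gdata_deriv d1) (gdata_deriv d2)).
pose (m := m1 * ga0 d1 + m2 * ga0 d2).
assert (Hm : 0 < m) by (apply Rplus_lt_0_compat; now apply Rmult_lt_0_compat).
assert (Hcoef : forall e1 e2, ga0 e1 = ga0 d1 -> ga0 e2 = ga0 d2 ->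
   (forall j, (1 <= j <= gN e1)%nat -> 0 <= ga e1 j) ->
   (forall j, (1 <= j <= gN e2)%nat -> 0 <= ga e2 j) -> forall r, r0 < r -> m <= coef e1 e2 r).
{ intros e1 e2 E1 E2 He1 He2 r Hr; unfold m, coef; rewrite <- E1, <- E2 in *.
  destruct (HF1 (Shat r) (hSbd r ltac:(lra))) as (A1 & _ & _).
  destruct (HF2 (Shat r) (hSbd r ltac:(lra))) as (A2 & _ & _).
  apply Rplus_le_compat; apply Rmult_le_compat; try lra; now apply gfun_lower. }
assert (Hbe : forall r, r0 < r -> m <= be r) by (apply Hcoef; auto).
assert (Hla : forall r, r0 < r -> m <= la r).
{ apply Hcoef; auto; simpl; intros j Hj; apply Rmult_le_pos; auto.
  - specialize (hd1al j Hj); lra.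
  - specialize (hd2al j Hj); lra. }
assert (Bal : bounded_C1 r0 (fun r => / be r)).
{ apply (bounded_C1_inv r0 m be Hm Hbe).
  apply bounded_C1_plus; apply bounded_C1_mult; try assumption; now apply bounded_C1_gfun. }
assert (Ba : bounded_C1 r0 (fun r => / la r)).
{ apply (bounded_C1_inv r0 m la Hm Hla).
  apply bounded_C1_plus; apply bounded_C1_mult; assumption. }
destruct Bal as (al' & Cal & Hal); destruct Ba as (a' & Ca & Ha).
assert (HAm : forall x, Udom n r0 x -> forall i j, (i < n)%nat -> (j < n)%nat ->
   Am x i j = radial_mat n (fun r => / be r) (fun r => / la r) x i j).
{ intros x [Hx Hxr] i j Hi Hj.
  assert (Hv : 0 < vnorm n x) by lra.
  assert (Hq : 0 < sqn n x) by (rewrite <- vnorm_sqr; nra).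
  pose proof (Hbe _ Hxr); pose proof (Hla _ Hxr).
  apply (radial_inverse n (Bmat d1 d2 pc f1 f2 c1 c2 n Shat x) (Am x)); try assumption; try lra.
  - intros i' j' _ _; unfold Bmat; rewrite !Gjac_ustar by (lia || assumption).
    unfold la, be, coef, s1, s2; ring.
  - intros i' k' Hi' Hk'; apply hA; try assumption; split; [exact Hx|lra]. }
pose (Cb := C2 * (G2 * Rabs c2) + C1 * (G1 * Rabs c1)).
assert (Hb : forall x, Udom n r0 x -> 1 <= vnorm n x ->
   Rabs (sum_lt n (fun i => bvec d1 d2 dF1 dF2 c1 c2 n Shat x i * x i)) <= Cb).
{ intros x [Hx Hxr] Hx1; set (v := vnorm n x) in *.
  assert (Hvn : 0 < v ^ n) by (apply pow_lt; lra).
  (* Here n >= 2 and |x| >= 1 are combined. *)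
  assert (Hq : 0 <= v * v / v ^ n <= 1).
  { split; [apply Rmult_le_pos; [nra|left; now apply Rinv_0_lt_compat]|].
    apply Rmult_le_reg_r with (v ^ n); [exact Hvn|].
    replace (v * v / v ^ n * v ^ n) with (v ^ 2) by (field; lra).
    rewrite Rmult_1_l; apply Rle_pow; [exact Hx1|lia]. }
  destruct (HF1 (Shat v) (hSbd v ltac:(lra))) as (_ & _ & A1).
  destruct (HF2 (Shat v) (hSbd v ltac:(lra))) as (_ & _ & A2).
  destruct (HG1 v Hxr) as (_ & A3 & _); destruct (HG2 v Hxr) as (_ & A4 & _).
  replace (sum_lt n (fun i => bvec d1 d2 dF1 dF2 c1 c2 n Shat x i * x i)) with
    (dF2 (Shat v) * (gfun d2 (Rabs c2 / v ^ (n - 1)) * (c2 * (v * v / v ^ n)))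
     + - (dF1 (Shat v) * (gfun d1 (Rabs c1 / v ^ (n - 1)) * (c1 * (v * v / v ^ n))))).
  (* Both u_i^* are multiples of x, so b.x is a radial factor times |x|^2. *)
  2:{ rewrite (sum_lt_ext n _ (fun i =>
        (dF2 (Shat v) * gfun d2 (Rabs c2 / v ^ (n - 1)) * c2
         - dF1 (Shat v) * gfun d1 (Rabs c1 / v ^ (n - 1)) * c1) / v ^ n * (x i * x i))).
      - rewrite sum_lt_scal; fold (sqn n x); rewrite <- vnorm_sqr; fold v; field; lra.
      - intros i Hi; unfold bvec, Gvec; rewrite !vnorm_ustar by (lia || (fold v; lra)).
        unfold ustar; fold v; field; lra. }
  eapply Rle_trans; [apply Rabs_triang|]; rewrite Rabs_Ropp, !Rabs_mult, (Rabs_right (v * v / v ^ n)) by lra.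
  assert (Hc : forall c, 0 <= Rabs c * (v * v / v ^ n) <= Rabs c).
  { intros c; pose proof (Rabs_pos c); split; [apply Rmult_le_pos; lra|].
    rewrite <- (Rmult_1_r (Rabs c)) at 2; apply Rmult_le_compat_l; lra. }
  pose proof (Hc c1); pose proof (Hc c2).
  apply Rplus_le_compat; apply Rmult_le_compat; try apply Rabs_pos; try assumption;
    try (apply Rmult_le_pos; [apply Rabs_pos|lra]);
    apply Rmult_le_compat; try apply Rabs_pos; lra || assumption. }
pose (C := Rmax Ca Cb).
assert (HaC : forall r, r0 < r -> / la r <= C /\ Rabs (a' r) <= C).
{ intros r Hr; destruct (Ha r Hr) as (_ & A1 & A2); pose proof (Rmax_l Ca Cb); unfold C.
  pose proof (Rle_abs (/ la r)); lra. }
assert (Hal' : forall r, r0 < r -> 0 < / be r /\ derivable_pt_lim (fun r => / be r) r (al' r)).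
{ intros r Hr; split; [apply Rinv_0_lt_compat; specialize (Hbe r Hr); lra|now apply Hal]. }
assert (Ha' : forall r, r0 < r -> 0 < / la r /\ derivable_pt_lim (fun r => / la r) r (a' r)).
{ intros r Hr; split; [apply Rinv_0_lt_compat; specialize (Hla r Hr); lra|now apply Ha]. }
assert (HbC : forall x, Udom n r0 x -> 1 <= vnorm n x ->
   Rabs (sum_lt n (fun i => bvec d1 d2 dF1 dF2 c1 c2 n Shat x i * x i)) <= C).
{ intros x H1 H2; apply Rle_trans with (1 := Hb x H1 H2), Rmax_r. }
assert (HUbar : forall x, Udom n r0 x -> Ubar n r0 x) by (intros x [H1 H2]; split; [exact H1|lra]).
destruct hwb as [M HM].
assert (Up : forall eps, 0 < eps -> exists R1, forall x t, inRn n x -> R1 < vnorm n x -> 0 <= t <= T ->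
    w x t <= eps).
{ apply (upper_decay n r0 T w wx wxx wt hwc hwx hwxx hwt hwxc hwxxc Am
    (bvec d1 d2 dF1 dF2 c1 c2 n Shat) f0 hL _ _ al' a' C hT hr0 Hal' Ha' HaC HAm HbC).
  - exists M; intros x t Hx; eapply Rle_trans; [apply Rle_abs|now apply HM].
  - intros e He; destruct (hw0lim e He) as [R1 H1]; exists R1; intros x Hx HR.
    rewrite hinit by exact Hx; eapply Rle_trans; [apply Rle_abs|]; auto.
  - intros e He; destruct (hf0lim e He) as [R1 H1]; exists R1; intros x Hx HR t Ht.
    eapply Rle_trans; [apply Rle_abs|]; auto. }
assert (Hopp : forall P f, cont_on_xt n P f -> cont_on_xt n P (fun x t => - f x t)).
{ intros P f Hf x t Hx e He; destruct (Hf x t Hx e He) as (d & Hd & H); exists d; split; [exact Hd|].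
  intros y s H1 H2 H3; replace (- f y s - - f x t) with (- (f y s - f x t)) by ring.
  rewrite Rabs_Ropp; auto. }
(* By linearity -w solves the equation with right-hand side -f0 and the same coefficients, so the
   upper bound applies to it as well. *)
assert (Low : forall eps, 0 < eps -> exists R1, forall x t, inRn n x -> R1 < vnorm n x -> 0 <= t <= T ->
    - w x t <= eps).
{ apply (upper_decay n r0 T (fun x t => - w x t) (fun i x t => - wx i x t)
     (fun i j x t => - wxx i j x t) (fun x t => - wt x t)) with (Am := Am)
    (b := bvec d1 d2 dF1 dF2 c1 c2 n Shat) (f0 := fun x t => - f0 x t)
    (al := fun r => / be r) (a := fun r => / la r) (al' := al') (a' := a') (C := C); auto.
  - intros x t Hx i Hi; apply (derivable_pt_lim_opp (fun h => w (shift x i h) t)); auto.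
  - intros x t Hx i j Hi Hj; apply (derivable_pt_lim_opp (fun h => wx j (shift x i h) t)); auto.
  - intros x t Hx e He; destruct (hwt x t Hx e He) as (d & Hd & H); exists d; split; [exact Hd|].
    intros h H1 H2 H3.
    replace ((- w x (t + h) - - w x t) / h - - wt x t)
      with (- ((w x (t + h) - w x t) / h - wt x t)) by (field; exact H1).
    rewrite Rabs_Ropp; auto.
  - intros x t Hx; destruct (hL x t Hx) as (dq & Hdq & H).
    assert (Eflux : forall y i, Aflux Am (fun i x t => - wx i x t) n y t i = - Aflux Am wx n y t i).
    { intros y i; unfold Aflux.
      rewrite <- (Rmult_1_l (sum_lt n (fun j => Am y i j * wx j y t))), Ropp_mult_distr_l, <- sum_lt_scal.
      apply sum_lt_ext; intros; ring. }
    exists (fun i => -1 * dq i); split.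
    + intros i Hi; apply derivable_pt_lim_eq with (fun h => - Aflux Am wx n (shift x i h) t i) (- dq i).
      * apply (derivable_pt_lim_opp (fun h => Aflux Am wx n (shift x i h) t i)); auto.
      * intros h; apply Eflux.
      * ring.
    + rewrite sum_lt_scal, <- H.
      rewrite (sum_lt_ext n (fun i => bvec d1 d2 dF1 dF2 c1 c2 n Shat x i *
         Aflux Am (fun i x t => - wx i x t) n x t i)
        (fun i => -1 * (bvec d1 d2 dF1 dF2 c1 c2 n Shat x i * Aflux Am wx n x t i)))
        by (intros; rewrite Eflux; ring).
      rewrite sum_lt_scal; ring.
  - exists M; intros x t Hx; eapply Rle_trans; [apply Rle_abs|rewrite Rabs_Ropp; now apply HM].
  - intros e He; destruct (hw0lim e He) as [R1 H1]; exists R1; intros x Hx HR.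
    rewrite hinit by exact Hx; eapply Rle_trans; [apply Rle_abs|rewrite Rabs_Ropp]; auto.
  - intros e He; destruct (hf0lim e He) as [R1 H1]; exists R1; intros x Hx HR t Ht.
    eapply Rle_trans; [apply Rle_abs|rewrite Rabs_Ropp]; auto. }
intros eps Heps; destruct (Up eps Heps) as [R1 H1]; destruct (Low eps Heps) as [R2 H2].
exists (Rmax R1 R2); intros r Hr x t Hx Hxr Ht.
pose proof (Rmax_l R1 R2); pose proof (Rmax_r R1 R2).
pose proof (H1 x t Hx ltac:(lra) Ht); pose proof (H2 x t Hx ltac:(lra) Ht).
apply Rabs_le; lra.
Qed.
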